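(* Let $W=W(\Gamma,\mathbf m)$ be a graph product of directly-indecomposable cyclic groups. Suppose that $\phi(W(\Delta_i))=W(\Delta_i)$ for each $1\le i\le N$ and each $\phi\in\operatorname{Aut}^1W$, where $\Delta_i=\{v_j\in V: S_i=S_j\}$. Then one may write $$\operatorname{Aut}^\ast W=\operatorname{Inn}W\rtimes(\operatorname{Out}^0W\rtimes\operatorname{Aut}^1W)\cong\operatorname{Inn}W\rtimes\operatorname{Out}^\ast W$$ (semidirect products of subgroups of $\operatorname{Aut}W$, the left-hand factor being normal in each case).
   Context: $\Gamma$ is a finite simplicial graph with non-empty vertex set $V=\{v_1,\dots,v_N\}$, with the indexing fixed. An order map is a function $\mathbf m:\{1,\dots,N\}\to\{p^\alpha : p \text{ prime},\ \alpha\ge 1\}\cup\{\infty\}$. The graph product of directly-indecomposable cyclic groups $W=W(\Gamma,\mathbf m)$ is the group with generators $V$ and relations $v_i^{\mathbf m(i)}=1$ (no relation if $\mathbf m(i)=\infty$) and $v_jv_k=v_kv_j$ whenever $v_j,v_k$ are adjacent in $\Gamma$. For a full subgraph (or set of vertices) $\Delta$, $W(\Delta)$ is the subgroup generated by the vertices of $\Delta$. The maximal complete subgroups are the $W(\Delta)$ with $\Delta$ a maximal complete subgraph. $S_i$ is the star of $v_i$ (the full subgraph on the vertices at distance at most $1$ from $v_i$). $\operatorname{Aut}^\ast W$ (resp. $\operatorname{Aut}^1W$) is the subgroup of $\operatorname{Aut}W$ of automorphisms which map each maximal complete subgroup to a conjugate of a maximal complete subgroup (resp. to a maximal complete subgroup).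 $\operatorname{Inn}W$ is the group of inner automorphisms. For $1\le i\le N$ and $K$ a connected component of $\Gamma\setminus S_i$, the partial conjugation $\chi_{iK}$ is the automorphism of $W$ with $\chi_{iK}(v_j)=v_iv_jv_i^{-1}$ if $v_j\in K$ and $\chi_{iK}(v_j)=v_j$ if $v_j\notin K$. For each $i$ with $\Gamma\setminus S_i\ne\emptyset$ let $j_i$ be minimal such that $v_{j_i}\in\Gamma\setminus S_i$; $\mathcal P^0$ is the set of partial conjugations $\chi_{iK}$ with $v_{j_i}\notin K$. $\operatorname{Out}^0W$ is the subgroup of $\operatorname{Aut}W$ generated by $\mathcal P^0$, and $\operatorname{Out}^\ast W$ is the subgroup of $\operatorname{Aut}W$ generated by $\mathcal P^0\cup\operatorname{Aut}^1W$. *)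

(* Defs.v *)
From HB Require Import structures.
From mathcomp Require Import all_boot.
From mathcomp Require Import boolp classical_sets.

Set Implicit Arguments.
Unset Strict Implicit.
Unset Printing Implicit Defensive.

Local Open Scope classical_set_scope.
Local Open Scope group_scope.
Local Open Scope quotient_scope.

(* Subgroups of a possibly infinite group, as classical sets; the {group gT} *)
(* of fingroup only covers finite groups.                                     *)

Definition is_subgroup (G : groupType) (H : set G) : Prop :=
  [/\ H 1, forall x y, H x -> H y -> H (x * y) & forall x, H x -> H x^-1].

Definition generated_subgroup (G : groupType) (A : set G) : set G :=
  smallest (@is_subgroup G) A.

Definition conj_subgroup (G : groupType) (w : G) (H : set G) : set G :=
  [set w * x * w^-1 | x in H].

Definition mul_set (G : groupType) (A B : set G) : set G :=
  [set z | exists x y, [/\ A x, B y & z = x * y]].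

(* K = A ><| B as an internal semidirect product, with A normal in K.         *)
Definition internal_sdprod (G : groupType) (A B K : set G) : Prop :=
  [/\ [/\ is_subgroup A, is_subgroup B & is_subgroup K],
      A `<=` K,
      forall k a, K k -> A a -> A (k * a * k^-1),
      A `&` B = [set 1]
    & K = mul_set A B].

Record aut (G : groupType) := Aut {
  aut_fun :> G -> G;
  autM : {morph aut_fun : x y / x * y};
  aut_bij : bijective aut_fun }.

HB.instance Definition _ (G : groupType) (f : aut G) :=
  isMultiplicative.Build G G (aut_fun f) (@autM G f).

HB.instance Definition _ (G : groupType) := gen_eqMixin (aut G).
HB.instance Definition _ (G : groupType) := gen_choiceMixin (aut G).

Lemma autP (G : groupType) (f g : aut G) : f =1 g -> f = g.
Proof.
case: f g => [f fM fb] [g gM gb] /= /funext E; case: _ / E gM gb => gM gb.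
by rewrite (Prop_irrelevance fM gM) (Prop_irrelevance fb gb).
Qed.

Definition aut_one (G : groupType) : aut G :=
  @Aut G id (fun _ _ => erefl) (Bijective (fun _ => erefl) (fun _ => erefl)).

Lemma aut_mulM (G : groupType) (f g : aut G) :
  {morph f \o g : x y / x * y}.
Proof. by move=> x y /=; rewrite !autM. Qed.

Definition aut_mul (G : groupType) (f g : aut G) : aut G :=
  Aut (aut_mulM f g) (bij_comp (aut_bij f) (aut_bij g)).

Lemma aut_inv_ex (G : groupType) (f : aut G) :
  exists2 g : G -> G, cancel f g & cancel g f.
Proof. by case: (aut_bij f) => g; exists g. Qed.

Definition aut_inv_fun (G : groupType) (f : aut G) : G -> G :=
  projT1 (cid2 (aut_inv_ex f)).

Lemma aut_funK (G : groupType) (f : aut G) : cancel f (aut_inv_fun f).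
Proof. by rewrite /aut_inv_fun; case: cid2. Qed.

Lemma aut_inv_funK (G : groupType) (f : aut G) : cancel (aut_inv_fun f) f.
Proof. by rewrite /aut_inv_fun; case: cid2. Qed.

Lemma aut_invM (G : groupType) (f : aut G) :
  {morph aut_inv_fun f : x y / x * y}.
Proof.
move=> x y; apply: (can_inj (aut_funK f)).
by rewrite autM !aut_inv_funK.
Qed.

Definition aut_inv (G : groupType) (f : aut G) : aut G :=
  Aut (@aut_invM G f) (Bijective (aut_inv_funK f) (aut_funK f)).

Lemma aut_mulA (G : groupType) : associative (@aut_mul G).
Proof. by move=> f g h; apply: autP. Qed.

Lemma aut_mul1 (G : groupType) : left_id (@aut_one G) (@aut_mul G).
Proof. by move=> f; apply: autP. Qed.

Lemma aut_1mul (G : groupType) : right_id (@aut_one G) (@aut_mul G).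
Proof. by move=> f; apply: autP. Qed.

Lemma aut_mulV (G : groupType) :
  left_inverse (@aut_one G) (@aut_inv G) (@aut_mul G).
Proof. by move=> f; apply: autP => x /=; rewrite aut_funK. Qed.

Lemma aut_Vmul (G : groupType) :
  right_inverse (@aut_one G) (@aut_inv G) (@aut_mul G).
Proof. by move=> f; apply: autP => x /=; rewrite aut_inv_funK. Qed.

HB.instance Definition _ (G : groupType) := isGroup.Build (aut G)
  (@aut_mulA G) (@aut_mul1 G) (@aut_1mul G) (@aut_mulV G) (@aut_Vmul G).

Definition Inn (G : groupType) : set (aut G) :=
  [set f : aut G | exists w : G, forall x, f x = w * x * w^-1].
Arguments Inn G _ : clear implicits.

(* Groups given by generators and relations. The letter (x, true) stands for *)
(* the generator x and (x, false) for its inverse; R u v is a relation u = v. *)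

Definition word (X : choiceType) := seq (X * bool).

Inductive pres_eq (X : choiceType) (R : word X -> word X -> Prop) :
    word X -> word X -> Prop :=
| pres_rel u v : R u v -> pres_eq R u v
| pres_cancel x b : pres_eq R [:: (x, b); (x, ~~ b)] [::]
| pres_refl u : pres_eq R u u
| pres_sym u v : pres_eq R u v -> pres_eq R v u
| pres_trans u v w : pres_eq R u v -> pres_eq R v w -> pres_eq R u w
| pres_cat u u' v v' :
    pres_eq R u u' -> pres_eq R v v' -> pres_eq R (u ++ v) (u' ++ v').

Definition pres_eqb (X : choiceType) (R : word X -> word X -> Prop) :
  rel (word X) := fun u v => `[< pres_eq R u v >].

Lemma pres_eqb_refl X R : reflexive (@pres_eqb X R).
Proof. by move=> u; apply/asboolP/pres_refl. Qed.

Lemma pres_eqb_sym X R : symmetric (@pres_eqb X R).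
Proof. by move=> u v; apply/asboolP/asboolP => /pres_sym. Qed.

Lemma pres_eqb_trans X R : transitive (@pres_eqb X R).
Proof.
by move=> v u w /asboolP uv /asboolP vw; apply/asboolP/(pres_trans uv vw).
Qed.

Canonical pres_equiv X R := EquivRel (@pres_eqb X R)
  (@pres_eqb_refl X R) (@pres_eqb_sym X R) (@pres_eqb_trans X R).

Definition presented (X : choiceType) (R : word X -> word X -> Prop) : Type :=
  {eq_quot pres_equiv R}.

HB.instance Definition _ X R := Choice.on (@presented X R).
HB.instance Definition _ X R := Quotient.on (@presented X R).

Definition pres_class X R (u : word X) : presented R := \pi_(presented R) u.

Lemma pres_classP X R (u v : word X) :
  pres_class R u = pres_class R v <-> pres_eq R u v.
Proof. by split=> [/eqmodP/asboolP|uv]; last exact/eqmodP/asboolP. Qed.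

Lemma pres_class_repr X R (a : @presented X R) : pres_class R (repr a) = a.
Proof. exact: reprK. Qed.

Definition word_inv X (u : word X) : word X :=
  rev [seq (l.1, ~~ l.2) | l <- u].

Definition pres_one X (R : word X -> word X -> Prop) : presented R :=
  pres_class R [::].
Definition pres_mul X R (a b : @presented X R) : presented R :=
  pres_class R (repr a ++ repr b).
Definition pres_inv X R (a : @presented X R) : presented R :=
  pres_class R (word_inv (repr a)).

Lemma pres_mulE X R (u v : word X) :
  pres_mul (pres_class R u) (pres_class R v) = pres_class R (u ++ v).
Proof. by apply/pres_classP/pres_cat; apply/pres_classP/pres_class_repr. Qed.

Lemma word_invK X : involutive (@word_inv X).
Proof.
move=> u; rewrite /word_inv map_rev revK -map_comp map_id_in // => -[x b] _ /=.
by rewrite negbK.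
Qed.

Lemma pres_eq_mulV X R (u : word X) : pres_eq R (u ++ word_inv u) [::].
Proof.
elim: u => [|[x b] u IHu]; first exact: pres_refl.
rewrite /word_inv map_cons rev_cons -rcons_cat -cats1 /=.
have E : pres_eq R ([:: (x, b)] ++ ((u ++ word_inv u) ++ [:: (x, ~~ b)]))
                   ([:: (x, b)] ++ ([::] ++ [:: (x, ~~ b)])).
  apply: pres_cat; first exact: pres_refl.
  by apply: pres_cat => //; apply: pres_refl.
exact: pres_trans E (pres_cancel R x b).
Qed.

Lemma pres_mulA X R : associative (@pres_mul X R).
Proof.
move=> a b c; rewrite -(pres_class_repr a) -(pres_class_repr b).
by rewrite -(pres_class_repr c) !pres_mulE catA.
Qed.

Lemma pres_mul1 X R : left_id (@pres_one X R) (@pres_mul X R).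
Proof. by move=> a; rewrite -(pres_class_repr a) pres_mulE. Qed.

Lemma pres_1mul X R : right_id (@pres_one X R) (@pres_mul X R).
Proof. by move=> a; rewrite -(pres_class_repr a) pres_mulE cats0. Qed.

Lemma pres_Vmul X R : right_inverse (@pres_one X R) (@pres_inv X R) (@pres_mul X R).
Proof.
move=> a; rewrite -{1}(pres_class_repr a) pres_mulE.
exact/pres_classP/pres_eq_mulV.
Qed.

Lemma pres_mulV X R : left_inverse (@pres_one X R) (@pres_inv X R) (@pres_mul X R).
Proof.
move=> a; rewrite -{2}(pres_class_repr a) pres_mulE; apply/pres_classP.
by rewrite -{2}(word_invK (repr a)); apply: pres_eq_mulV.
Qed.

HB.instance Definition _ X R := isGroup.Build (@presented X R)
  (@pres_mulA X R) (@pres_mul1 X R) (@pres_1mul X R)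
  (@pres_mulV X R) (@pres_Vmul X R).

Lemma pres_class_cat X R (u v : word X) :
  pres_class R (u ++ v) = pres_class R u * pres_class R v.
Proof. by rewrite -pres_mulE. Qed.

Lemma pres_class_nil X R : pres_class R [::] = 1 :> @presented X R.
Proof. by []. Qed.

Definition pres_gen (X : choiceType) R (x : X) : presented R := pres_class R [:: (x, true)].

Definition word_eval (X : choiceType) (G : groupType) (h : X -> G)
    (u : word X) : G :=
  foldr (fun l => *%g (if l.2 then h l.1 else (h l.1)^-1)) 1 u.

Lemma word_eval_cat (X : choiceType) (G : groupType) (h : X -> G) u v :
  word_eval h (u ++ v) = word_eval h u * word_eval h v.
Proof. by elim: u => [|l u IHu] /=; rewrite ?mul1g // IHu mulgA. Qed.

Lemma word_eval_nseq (X : choiceType) (G : groupType) (h : X -> G) n x :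
  word_eval h (nseq n (x, true)) = h x ^+ n.
Proof. by elim: n => //= n ->; rewrite expgS. Qed.

Lemma word_eval_pres_eq (X : choiceType) R (G : groupType) (h : X -> G) :
  (forall u v, R u v -> word_eval h u = word_eval h v) ->
  forall u v, pres_eq R u v -> word_eval h u = word_eval h v.
Proof.
move=> hR u v; elim=> {u v} //.
- by move=> x [] /=; rewrite mulg1 ?mulgV ?mulVg.
- by move=> u v w _ -> _ ->.
- by move=> u u' v v' _ Eu _ Ev; rewrite !word_eval_cat Eu Ev.
Qed.

Lemma presented_lift (X : choiceType) (R : word X -> word X -> Prop)
    (G : groupType) (h : X -> G) :
  (forall u v, R u v -> word_eval h u = word_eval h v) ->
  exists f : presented R -> G,
    {morph f : x y / x * y} /\ forall x, f (pres_gen R x) = h x.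
Proof.
move=> /word_eval_pres_eq hR.
have liftE u : word_eval h (repr (pres_class R u)) = word_eval h u.
  by apply/hR/pres_classP/pres_class_repr.
exists (fun a => word_eval h (repr a)); split; last first.
  by move=> x; rewrite liftE /= mulg1.
by move=> a b; rewrite liftE word_eval_cat.
Qed.

Lemma presented_morph_eq (X : choiceType) (R : word X -> word X -> Prop)
    (G : groupType) (f g : presented R -> G) :
  {morph f : x y / x * y} -> {morph g : x y / x * y} ->
  (forall x, f (pres_gen R x) = g (pres_gen R x)) -> f =1 g.
Proof.
move=> fM gM fg a; rewrite -(pres_class_repr a).
have morph1 (k : presented R -> G) : {morph k : x y / x * y} -> k 1 = 1.
  by move=> kM; apply: (mulgI (k 1)); rewrite -kM !mulg1.
have morphV (k : presented R -> G) x :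
    {morph k : x y / x * y} -> k x^-1 = (k x)^-1.
  by move=> kM; apply: (mulgI (k x)); rewrite -kM !mulgV morph1.
elim: (repr a) => [|[x b] u IHu].
  by rewrite pres_class_nil !morph1.
have -> : pres_class R ((x, b) :: u) =
    (if b then pres_gen R x else (pres_gen R x)^-1) * pres_class R u.
  rewrite -cat1s pres_class_cat; congr (_ * _); case: b => //.
  apply: (mulgI (pres_gen R x)); rewrite mulgV -pres_class_cat -pres_class_nil.
  exact/pres_classP/(pres_cancel R x true).
rewrite fM gM IHu; congr (_ * _).
by case: b; rewrite ?morphV ?fg.
Qed.

(* Graph products of cyclic groups. A finite simplicial graph with indexed    *)
(* vertices is a symmetric irreflexive e : rel 'I_N; the order m i = None is  *)
(* infinite and m i = Some q is the finite order q.                           *)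

Definition simplicial_graph (N : nat) (e : rel 'I_N) : Prop :=
  symmetric e /\ irreflexive e.

Definition order_map (N : nat) (m : 'I_N -> option nat) : Prop :=
  forall i q, m i = Some q ->
    exists p a : nat, [/\ prime p, (0 < a)%N & q = (p ^ a)%N].

Inductive gprod_rel (N : nat) (e : rel 'I_N) (m : 'I_N -> option nat) :
    word 'I_N -> word 'I_N -> Prop :=
| gprod_order i q :
    m i = Some q -> gprod_rel e m (nseq q (i, true)) [::]
| gprod_comm j k :
    e j k -> gprod_rel e m [:: (j, true); (k, true)] [:: (k, true); (j, true)].

Notation graph_product e m := (presented (gprod_rel e m)).

Definition vertex (N : nat) (e : rel 'I_N) (m : 'I_N -> option nat)
  (i : 'I_N) : graph_product e m := pres_gen (gprod_rel e m) i.

Definition vertex_subgroup (N : nat) (e : rel 'I_N) (m : 'I_N -> option nat)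
    (D : {set 'I_N}) : set (graph_product e m) :=
  generated_subgroup [set vertex e m j | j in [set` D]].
Arguments vertex_subgroup {N} e m D _.

Definition star (N : nat) (e : rel 'I_N) (i : 'I_N) : {set 'I_N} :=
  [set j | (j == i) || e i j]%SET.

Definition complete (N : nat) (e : rel 'I_N) (D : {set 'I_N}) : bool :=
  [forall j in D, forall k in D, (j != k) ==> e j k].

Definition max_complete (N : nat) (e : rel 'I_N) (D : {set 'I_N}) : bool :=
  maxset (complete e) D.

Definition same_star (N : nat) (e : rel 'I_N) (i : 'I_N) : {set 'I_N} :=
  [set j | star e i == star e j]%SET.

(* K is a connected component of the full subgraph spanned by D. *)
Definition is_component (N : nat) (e : rel 'I_N) (D K : {set 'I_N}) : Prop :=
  exists2 x, x \in D &
    K = [set y in D | connect [rel u v | [&& u \in D, v \in D & e u v]] x y]%SET.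

Definition is_partial_conj (N : nat) (e : rel 'I_N) (m : 'I_N -> option nat)
    (i : 'I_N) (K : {set 'I_N}) (f : aut (graph_product e m)) : Prop :=
  forall j, f (vertex e m j) =
    if j \in K then vertex e m i * vertex e m j * (vertex e m i)^-1
    else vertex e m j.

Lemma partial_conj_unique (N : nat) (e : rel 'I_N) (m : 'I_N -> option nat)
    (i : 'I_N) (K : {set 'I_N}) (f g : aut (graph_product e m)) :
  is_partial_conj i K f -> is_partial_conj i K g -> f = g.
Proof.
move=> fP gP; apply/autP/presented_morph_eq; try exact: autM.
by move=> j; rewrite fP gP.
Qed.

Lemma partial_conj_exists (N : nat) (e : rel 'I_N) (m : 'I_N -> option nat)
    (i : 'I_N) (K : {set 'I_N}) :
  simplicial_graph e -> is_component e (~: star e i)%SET K ->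
  exists f : aut (graph_product e m), is_partial_conj i K f.
Proof.
move=> [esym eirr] [x xD KE].
pose v := vertex e m.
have inK j : j \in K -> j \notin star e i.
  by rewrite KE inE => /andP[+ _]; rewrite inE.
have iK : i \notin K by apply/negP => /inK; rewrite inE eqxx.
have Ke j k : j \in K -> e j k -> k \notin K -> e i k.
  move=> jK ejk; apply: contraNT => eik.
  have kS : k \in (~: star e i)%SET.
    rewrite !inE negb_or eik andbT; apply/eqP => ki.
    by have := inK _ jK; rewrite inE -ki esym ejk orbT.
  move: jK; rewrite KE !inE => /andP[jS xj].
  move: kS; rewrite !inE => kS; rewrite kS /=.
  by apply/(connect_trans xj)/connect1; rewrite /= !inE jS kS.
have vC j k : e j k -> v j * v k = v k * v j.
  move=> ejk; rewrite -!pres_class_cat.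
  exact/pres_classP/pres_rel/gprod_comm.
have vX j q : m j = Some q -> v j ^+ q = 1.
  move=> mj; have -> : v j ^+ q = pres_class _ (nseq q (j, true)).
    by elim: q {mj} => // q IHq; rewrite expgS IHq -pres_class_cat.
  rewrite -pres_class_nil; exact/pres_classP/pres_rel/gprod_order.
have ext (t : graph_product e m) : (forall k, e i k -> commute t (v k)) ->
    exists f : graph_product e m -> graph_product e m,
    {morph f : x y / x * y} /\
    forall j, f (v j) = if j \in K then t * v j * t^-1 else v j.
  move=> tC; apply: presented_lift => _ _ [j q /vX vj|j k ejk].
    rewrite word_eval_nseq /=; case: ifP => // _.
    have -> : t * v j * t^-1 = v j ^ t^-1 by rewrite /conjg invgK mulgA.
    by rewrite -conjXg vj conj1g.
  have vjk := vC _ _ ejk.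
  have aux a b : a \in K -> b \notin K -> e a b ->
      (t * v a * t^-1) * v b = v b * (t * v a * t^-1).
    move=> aK bK eab; have tb := tC _ (Ke _ _ aK eab bK).
    have tVb : commute t^-1 (v b) by apply/commute_sym/commuteV/commute_sym.
    by rewrite -!mulgA tVb !mulgA -(mulgA t) (vC _ _ eab) !mulgA tb.
  rewrite /= !mulg1; case: ifPn => jK; case: ifPn => kK //.
  - by rewrite !mulgA !mulgVK -!(mulgA t) vjk.
  - exact: aux.
  - by rewrite -aux // esym.
have vCi k : e i k -> commute (v i) (v k) by move=> /vC.
have [f [fM fE]] := ext (v i) vCi.
have [g [gM gE]] := ext (v i)^-1 (fun k ik =>
  commute_sym (commuteV (commute_sym (vCi k ik)))).
have morphV (k : graph_product e m -> graph_product e m) a :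
    {morph k : x y / x * y} -> k a^-1 = (k a)^-1.
  move=> kM; have k1 : k 1 = 1 by apply: (mulgI (k 1)); rewrite -kM !mulg1.
  by apply: (mulgI (k a)); rewrite -kM !mulgV k1.
have fgK : cancel f g.
  apply: (@presented_morph_eq _ _ _ (g \o f) id) => //.
    by move=> a b /=; rewrite fM gM.
  move=> j /=; rewrite fE; case: ifPn => jK; last by rewrite gE (negbTE jK).
  rewrite !gM (morphV g) // !gE jK (negbTE iK) invgK.
  by rewrite !mulgA mulgV mul1g mulgK.
have gfK : cancel g f.
  apply: (@presented_morph_eq _ _ _ (f \o g) id) => //.
    by move=> a b /=; rewrite gM fM.
  move=> j /=; rewrite gE; case: ifPn => jK; last by rewrite fE (negbTE jK).
  rewrite !fM !(morphV f) // !fE jK (negbTE iK) invgK.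
  by rewrite !mulgA mulVg mul1g mulgVK.
by exists (Aut fM (Bijective fgK gfK)).
Qed.

(* The set P^0, with j = j_i the first vertex outside the star of i. *)
Definition partial_conj0 (N : nat) (e : rel 'I_N) (m : 'I_N -> option nat) :
    set (aut (graph_product e m)) :=
  [set f : aut (graph_product e m) | exists (i : 'I_N) (K : {set 'I_N}) (j : 'I_N),
    [/\ is_component e (~: star e i)%SET K,
        j \notin star e i,
        forall k : 'I_N, k \notin star e i -> (j <= k)%N,
        j \notin K
      & is_partial_conj i K f]].
Arguments partial_conj0 {N} e m _.

Definition AutStar (N : nat) (e : rel 'I_N) (m : 'I_N -> option nat) :
    set (aut (graph_product e m)) :=
  [set f : aut (graph_product e m) | forall D, max_complete e D ->
    exists (w : graph_product e m) (D' : {set 'I_N}),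
      max_complete e D' /\
      f @` vertex_subgroup e m D = conj_subgroup w (vertex_subgroup e m D')].
Arguments AutStar {N} e m _.

Definition Aut1 (N : nat) (e : rel 'I_N) (m : 'I_N -> option nat) :
    set (aut (graph_product e m)) :=
  [set f : aut (graph_product e m) | forall D, max_complete e D ->
    exists D' : {set 'I_N},
      max_complete e D' /\
      f @` vertex_subgroup e m D = vertex_subgroup e m D'].
Arguments Aut1 {N} e m _.

(* Despite their names, Out0 and OutStar are subgroups of Aut W, not of Out W. *)
Definition Out0 (N : nat) (e : rel 'I_N) (m : 'I_N -> option nat) :
    set (aut (graph_product e m)) :=
  generated_subgroup (partial_conj0 e m).
Arguments Out0 {N} e m _.

Definition OutStar (N : nat) (e : rel 'I_N) (m : 'I_N -> option nat) :
    set (aut (graph_product e m)) :=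
  generated_subgroup (partial_conj0 e m `|` Aut1 e m).
Arguments OutStar {N} e m _.

(* Main.v *)
(* Inner automorphisms and partial conjugations map the vertices of each      *)
(* clique to simultaneous conjugates ("clique-conjugating" automorphisms).    *)
(* An f in Aut^* W maps W(D) onto u_D W(D') u_D^-1; the maps                  *)
(* x |-> u_D^-1 f(x) u_D on W(D) glue to an a in Aut^1 W, because conjugate   *)
(* elements of the abelian subgroups W(D') are equal, and f a^-1 is           *)
(* clique-conjugating.                                                        *)
(* If f is clique-conjugating with f(v_i) = w_i v_i w_i^-1, consider the      *)
(* walls H_i = w_i W(S_i). For k outside S_i the wall H_k lies in one sector  *)
(* of H_i, which is constant on the components K of the complement of S_i.    *)
(* If that sector is not the one of 1, composing with a power of chi_iK       *)
(* brings the walls H_k, k in K, closer to 1. If this never happens, the      *)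
(* f(v_i) play ping-pong, so that the elements not separated from 1 by any    *)
(* H_i have disjoint translates under f(W) = W; hence 1 is the only one, and  *)
(* f = 1. So f is a product of partial conjugations, and these lie in         *)
(* Inn W . Out^0 W since the product over K of the chi_iK is conjugation by   *)
(* v_i.                                                                       *)
(* The intersections are trivial: a clique-conjugating a in Aut^1 W fixes     *)
(* every vertex, and if conjugation by x is in Out^0 W then x is in each      *)
(* W(S_k), by induction on k, as Out^0 W fixes v_k modulo the vertices other  *)
(* than v_k outside one of S_1, ..., S_(k-1). The hypothesis on Delta_i makes *)
(* phi chi_iK phi^-1 the product of powers of the chi_lK, l in Delta_i,       *)
(* prescribed by phi(v_i).                                                    *)

From HB Require Import structures.
From mathcomp Require Import all_boot zmodp.
From mathcomp Require Import boolp classical_sets.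
Require Import Defs.

Set Implicit Arguments.
Unset Strict Implicit.
Unset Printing Implicit Defensive.

Local Open Scope classical_set_scope.

(** Everything passes through the subgroup C of clique-conjugating automorphisms.
    [AutStar_decomposition] factors Aut^* W as C . Aut^1 W and [clique_conjugating_Inn_Out0] factors
    C as Inn W . Out^0 W; the factors meet trivially by [Aut1_clique_conjugating_trivial] and
    [Inn_Out0_trivial]. The hypothesis on Delta_i enters through [Aut1_normalises_Out0], which makes
    Out^0 W . Aut^1 W a group, equal to Out^* W. The geometric core is that partial conjugations
    generate C: [clique_conjugating_generated] is a descent on the lengths of conjugators, and
    [unseparated_trivial] is its terminal case. Positions relative to walls are computed with the
    cocycle [crossing]. *)

Ltac free_group :=
  rewrite !(invgM, invgK, invg1, mulgA, mulgK, mulgVK, mulgV, mulVg, mul1g,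
    mulg1).

(** * Subgroups and morphisms of arbitrary groups *)

Section Groups.
Local Open Scope group_scope.
Variable G : groupType.
Implicit Types (A B H : set G) (x y z w : G).

Lemma generated_sub A x : A x -> generated_subgroup A x.
Proof. by move=> Ax H [_ AH]; apply: AH. Qed.

Lemma generated_subgroupP A : is_subgroup (generated_subgroup A).
Proof.
split=> [H [[]] //|x y Hx Hy H HA|x Hx H HA].
  have [_ HM _] := HA.1; by apply: HM; [apply: Hx|apply: Hy].
by have [_ _ HV] := HA.1; apply: HV; exact: Hx.
Qed.

Lemma generated_min A H :
  is_subgroup H -> A `<=` H -> generated_subgroup A `<=` H.
Proof. exact: smallest_sub. Qed.

Lemma centraliser_subgroup A : is_subgroup [set x | forall y, A y -> commute x
  y].
Proof.
split=> [y _|x z cx cz y Ay|x cx y Ay] /=.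
- exact/commute_sym/commute1.
- by apply/commute_sym/commuteM; apply/commute_sym; [apply: cx|apply: cz].
- exact/commute_sym/commuteV/commute_sym/cx.
Qed.

Lemma conjM x y z : x * (y * z) * x^-1 = (x * y * x^-1) * (x * z * x^-1).
Proof. by free_group. Qed.

Lemma conj_commute x y : commute x y -> x * y * x^-1 = y.
Proof. by move=> ->; rewrite mulgK. Qed.

Lemma commute_conj x y : x * y * x^-1 = y -> commute x y.
Proof. by move=> E; rewrite /commute -{2}E mulgVK. Qed.

Lemma mul_set_subgroup A B : is_subgroup A -> is_subgroup B ->
    (forall b a, B b -> A a -> A (b * a * b^-1)) -> is_subgroup (mul_set A B).
Proof.
move=> [A1 AM AV] [B1 BM BV] nAB; split; first by exists 1, 1; rewrite mulg1.
  move=> _ _ [a [b [Aa Bb ->]]] [a' [b' [Aa' Bb' ->]]].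
  exists (a * (b * a' * b^-1)), (b * b'); split; last by free_group.
    exact/AM/nAB.
  exact: BM.
move=> _ [a [b [Aa Bb ->]]].
exists (b^-1 * a^-1 * b^-1^-1), b^-1; split; last by free_group.
  by apply: nAB; [apply: BV|apply: AV].
exact: BV.
Qed.

Lemma internal_sdprodP A B H : is_subgroup A -> is_subgroup B ->
    is_subgroup H -> A `<=` H -> B `<=` H ->
    (forall h a, H h -> A a -> A (h * a * h^-1)) ->
    (forall x, A x -> B x -> x = 1) -> H `<=` mul_set A B ->
  internal_sdprod A B H.
Proof.
move=> sA sB sH AH BH nAH tAB HAB; split=> //.
  apply/seteqP; split=> [x [/tAB AxB /AxB -> //]|x ->].
  by case: sA sB => [A1 _ _] [B1 _ _].
apply/seteqP; split=> // _ [a [b [/AH Ha /BH Hb ->]]].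
by case: sH => _ HM _; apply: HM.
Qed.

Lemma morph_one (K : groupType) (f : G -> K) :
  {morph f : x y / x * y} -> f 1 = 1.
Proof. by move=> fM; apply: (mulgI (f 1)); rewrite -fM !mulg1. Qed.

Lemma morph_inv (K : groupType) (f : G -> K) x :
  {morph f : x y / x * y} -> f x^-1 = (f x)^-1.
Proof.
by move=> fM; apply: (mulgI (f x)); rewrite -fM !mulgV morph_one.
Qed.

Lemma preim_subgroup (K : groupType) (f : G -> K) (H : set K) :
  {morph f : x y / x * y} -> is_subgroup H -> is_subgroup [set x | H (f x)].
Proof.
move=> fM [H1 HM HV]; split=> /= [|x y Hx Hy|x Hx].
- by rewrite morph_one.
- by rewrite fM; apply: HM.
- by rewrite morph_inv //; apply: HV.
Qed.

Lemma equaliser_subgroup (K : groupType) (f g : G -> K) :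
  {morph f : x y / x * y} -> {morph g : x y / x * y} ->
  is_subgroup [set x | f x = g x].
Proof.
move=> fM gM; split=> /= [|x y fx fy|x fx].
- by rewrite !morph_one.
- by rewrite fM gM fx fy.
- by rewrite !morph_inv // fx.
Qed.

Lemma conj_morph w : {morph (fun x => w * x * w^-1) : x y / x * y}.
Proof. by move=> x y; rewrite conjM. Qed.

End Groups.

(** * Automorphisms and inner automorphisms *)

Section Automorphisms.
Local Open Scope group_scope.
Variable G : groupType.
Implicit Types (f g : aut G) (x w : G).

Lemma aut_mulE f g x : (f * g) x = f (g x). Proof. by []. Qed.

Lemma aut_oneE x : (1 : aut G) x = x. Proof. by []. Qed.

Lemma aut1 f : f 1 = 1. Proof. exact/morph_one/autM. Qed.

Lemma autV f x : f x^-1 = (f x)^-1. Proof. exact/morph_inv/autM. Qed.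

Lemma autJ f w x : f (w * x * w^-1) = f w * f x * (f w)^-1.
Proof. by rewrite !autM autV. Qed.

Lemma autK f : cancel f f^-1. Proof. exact: aut_funK. Qed.

Lemma autVK f : cancel f^-1 f. Proof. exact: aut_inv_funK. Qed.

Lemma aut_inj f : injective f. Proof. exact: can_inj (autK f). Qed.

Definition inner_aut w : aut G :=
  Aut (conj_morph w) (Bijective
    (fun x => (ltac:(by free_group) : w^-1 * (w * x * w^-1) * w = x))
    (fun x => (ltac:(by free_group) : w * (w^-1 * x * w) * w^-1 = x))).

Lemma inner_autE w x : inner_aut w x = w * x * w^-1. Proof. by []. Qed.

Lemma inner_autM w w' : inner_aut (w * w') = inner_aut w * inner_aut w'.
Proof. by apply: autP => x; rewrite aut_mulE !inner_autE; free_group. Qed.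

Lemma InnP f : Inn G f <-> exists w, f = inner_aut w.
Proof.
by split=> [[w fE]|[w ->]]; exists w => //; apply: autP => x; rewrite fE.
Qed.

Lemma Inn_subgroup : is_subgroup (Inn G).
Proof.
split.
- by exists 1 => x; free_group.
- move=> _ _ /InnP[w ->] /InnP[w' ->]; apply/InnP; exists (w * w').
  by rewrite inner_autM.
- move=> _ /InnP[w ->]; apply/InnP; exists w^-1.
  apply: (mulIg (inner_aut w)); rewrite mulVg -inner_autM mulVg.
  by apply: autP => x; rewrite inner_autE; free_group.
Qed.

Lemma Inn_normal f g : Inn G g -> Inn G (f * g * f^-1).
Proof.
move=> [w gE]; exists (f w) => x.
by rewrite !aut_mulE gE autJ autVK.
Qed.

End Automorphisms.

(* A morphism from G to this group that is the identity on the second         *)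
(* component is a crossed homomorphism from G to the functions G -> A.        *)
Section Wreath.
Local Open Scope group_scope.
Variables G A : groupType.

Definition wreath : Type := ((G -> A) * G)%type.

HB.instance Definition _ := gen_eqMixin wreath.
HB.instance Definition _ := gen_choiceMixin wreath.

Definition wreath_mul (a b : wreath) : wreath :=
  (fun x => a.1 x * b.1 (a.2^-1 * x), a.2 * b.2).
Definition wreath_one : wreath := (fun=> 1, 1).
Definition wreath_inv (a : wreath) : wreath :=
  (fun x => (a.1 (a.2 * x))^-1, a.2^-1).

Lemma wreath_mulA : associative wreath_mul.
Proof.
move=> a b c; congr (_, _); last exact: mulgA.
by apply/funext => x /=; rewrite invgM !mulgA.
Qed.

Lemma wreath_mul1 : left_id wreath_one wreath_mul.
Proof.
case=> a g; congr (_, _); last exact: mul1g.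
by apply/funext => x /=; free_group.
Qed.

Lemma wreath_1mul : right_id wreath_one wreath_mul.
Proof.
by case=> a g; congr (_, _); [apply/funext => x /=|]; exact: mulg1.
Qed.

Lemma wreath_mulV : left_inverse wreath_one wreath_inv wreath_mul.
Proof.
case=> a g; congr (_, _); last exact: mulVg.
by apply/funext => x /=; rewrite invgK mulVg.
Qed.

Lemma wreath_Vmul : right_inverse wreath_one wreath_inv wreath_mul.
Proof.
case=> a g; congr (_, _); last exact: mulgV.
by apply/funext => x /=; rewrite mulVKg mulgV.
Qed.

HB.instance Definition _ := isGroup.Build wreath
  wreath_mulA wreath_mul1 wreath_1mul wreath_mulV wreath_Vmul.

End Wreath.

(** * Graph products: universal property and word length *)

Section GraphProduct.
Local Open Scope group_scope.
Variables (N : nat) (e : rel 'I_N) (m : 'I_N -> option nat).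
Local Notation W := (graph_product e m).
Local Notation v := (vertex e m).
Local Notation P := (vertex_subgroup e m).
Implicit Types D E : {set 'I_N}.

Lemma vertex_order i q : m i = Some q -> v i ^+ q = 1.
Proof.
move=> mi; have -> : v i ^+ q = pres_class _ (nseq q (i, true)).
  by elim: q {mi} => // q IHq; rewrite expgS IHq -pres_class_cat.
by rewrite -pres_class_nil; apply/pres_classP/pres_rel/gprod_order.
Qed.

Lemma vertex_commute i j : e i j -> commute (v i) (v j).
Proof.
move=> eij; rewrite /commute -!pres_class_cat.
exact/pres_classP/pres_rel/gprod_comm.
Qed.

Lemma graph_product_lift (G : groupType) (h : 'I_N -> G) :
    (forall i q, m i = Some q -> h i ^+ q = 1) ->
    (forall i j, e i j -> commute (h i) (h j)) ->
  exists f : W -> G, {morph f : x y / x * y} /\ forall i, f (v i) = h i.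
Proof.
move=> hX hC; apply: presented_lift => _ _ [i q /hX|i j /hC] /=.
  by rewrite word_eval_nseq.
by rewrite !mulg1.
Qed.

Definition letter (l : 'I_N * bool) : W := if l.2 then v l.1 else (v l.1)^-1.

Lemma pres_class_letter l : pres_class (gprod_rel e m) [:: l] = letter l.
Proof.
case: l => i [] //; apply: (mulgI (v i)); rewrite mulgV -pres_class_cat.
exact/pres_classP/(pres_cancel _ i true).
Qed.

Lemma pres_class_cons l u :
  pres_class (gprod_rel e m) (l :: u) = letter l * pres_class _ u.
Proof. by rewrite -cat1s pres_class_cat pres_class_letter. Qed.

Lemma pres_class_rcons l u :
  pres_class (gprod_rel e m) (rcons u l) = pres_class _ u * letter l.
Proof. by rewrite -cats1 pres_class_cat pres_class_letter. Qed.

Definition short (n : nat) (x : W) : Prop :=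
  exists2 u, (size u <= n)%N & pres_class (gprod_rel e m) u = x.

Lemma short_exists x : exists n, short n x.
Proof. by exists (size (repr x)), (repr x) => //; apply: pres_class_repr. Qed.

Lemma short0 x : short 0 x -> x = 1.
Proof. by case=> u; rewrite leqn0 => /nilP ->. Qed.

Lemma short_leq n k x : (n <= k)%N -> short n x -> short k x.
Proof. by move=> nk [u un <-]; exists u => //; apply: leq_trans nk. Qed.

Lemma short_rcons n x l : short n x -> short n.+1 (x * letter l).
Proof.
by move=> [u un <-]; exists (rcons u l); rewrite ?size_rcons ?pres_class_rcons.
Qed.

Lemma shortS_head n x : short n.+1 x ->
  x = 1 \/ exists l y, short n y /\ x = letter l * y.
Proof.
move=> [[|l u] un <-]; [by left|right].
by exists l, (pres_class _ u); rewrite pres_class_cons; split=> //; exists u.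
Qed.

Lemma shortS_last n x : short n.+1 x ->
  x = 1 \/ exists l y, short n y /\ x = y * letter l.
Proof.
move=> [u]; elim/last_ind: u => [|u l _]; first by left.
rewrite size_rcons => un <-; right; exists l, (pres_class _ u).
by rewrite pres_class_rcons; split=> //; exists u.
Qed.

(** * Vertex subgroups and retractions *)

Lemma vertex_subgroupP D : is_subgroup (P D).
Proof. exact: generated_subgroupP. Qed.

Lemma vertex_subgroup1 D : P D 1. Proof. by case: (vertex_subgroupP D). Qed.

Lemma vertex_subgroupM D x y : P D x -> P D y -> P D (x * y).
Proof. by case: (vertex_subgroupP D) => _ + _; apply. Qed.

Lemma vertex_subgroupV D x : P D x -> P D x^-1.
Proof. by case: (vertex_subgroupP D) => _ _; apply. Qed.

Lemma vertex_subgroup_vertex D i : i \in D -> P D (v i).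
Proof. by move=> iD; apply: generated_sub; exists i. Qed.

Lemma vertex_subgroup_min D (H : set W) :
  is_subgroup H -> (forall i, i \in D -> H (v i)) -> P D `<=` H.
Proof. by move=> sH DH; apply: generated_min => // _ [i iD <-]; apply: DH. Qed.

Lemma vertex_subgroupS D E : D \subset E -> P D `<=` P E.
Proof.
move=> /fintype.subsetP DE; apply: vertex_subgroup_min (vertex_subgroupP E) _
  => i /DE.
exact: vertex_subgroup_vertex.
Qed.

Lemma vertex_subgroup_morph_eq (G : groupType) (f g : W -> G) D :
    {morph f : x y / x * y} -> {morph g : x y / x * y} ->
    (forall i, i \in D -> f (v i) = g (v i)) ->
  forall x, P D x -> f x = g x.
Proof.
by move=> fM gM fg; apply: vertex_subgroup_min (equaliser_subgroup fM gM) _.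
Qed.

Lemma vertex_subgroup_commute D E x y :
    (forall i j, i \in D -> j \in E -> commute (v i) (v j)) ->
  P D x -> P E y -> commute x y.
Proof.
move=> cDE; have := vertex_subgroup_min (centraliser_subgroup (P E)) _.
move=> /(_ D) H Dx Ey; apply: H (Dx) y Ey => i iD y Ey.
have := vertex_subgroup_min (centraliser_subgroup [set v i]) _.
move=> /(_ E) H; apply/commute_sym/(H _ y Ey (v i) erefl) => j jE _ ->.
exact/commute_sym/cDE.
Qed.

Lemma vertex_subgroup1_commute i x y :
  P [set i]%SET x -> P [set i]%SET y -> commute x y.
Proof.
by apply: vertex_subgroup_commute => j k /set1P-> /set1P->; apply: commute_refl.
Qed.

Lemma retraction_exists (D : {set 'I_N}) : exists f : W -> W,
  {morph f : x y / x * y} /\ forall i, f (v i) = if i \in D then v i else 1.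
Proof.
apply: graph_product_lift => [i q /vertex_order vi|i j /vertex_commute vij].
  by case: ifP => // _; rewrite expg1n.
case: ifP => _; last exact/commute_sym/commute1.
by case: ifP => _; last exact: commute1.
Qed.

Definition retraction (D : {set 'I_N}) : W -> W :=
  projT1 (cid (retraction_exists D)).
Local Notation rho := retraction.

Lemma retractionM D : {morph rho D : x y / x * y}.
Proof. by rewrite /retraction; case: cid => f []. Qed.

Lemma retraction_vertex D i : rho D (v i) = if i \in D then v i else 1.
Proof. by rewrite /retraction; case: cid => f []. Qed.

Lemma retractionV D x : rho D x^-1 = (rho D x)^-1.
Proof. exact/morph_inv/retractionM. Qed.

Lemma retraction1 D : rho D 1 = 1.
Proof. exact/morph_one/retractionM. Qed.

Lemma retraction_id D x : P D x -> rho D x = x.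
Proof.
apply: (@vertex_subgroup_morph_eq _ _ id); [exact: retractionM|by []|].
by move=> i iD; rewrite retraction_vertex iD.
Qed.

Lemma graph_product_ind (H : set W) :
  is_subgroup H -> (forall i, H (v i)) -> forall x, H x.
Proof.
move=> [H1 HM HV] Hv x; rewrite -(pres_class_repr x).
elim: (repr x) => [|[i b] u IHu]; first exact: H1.
by rewrite pres_class_cons; apply: HM => //; case: b; [apply: Hv|apply: HV;
  apply: Hv].
Qed.

Lemma retraction_in D x : P D (rho D x).
Proof.
apply: (graph_product_ind
  (preim_subgroup (@retractionM D) (vertex_subgroupP D))) => i /=.
rewrite retraction_vertex; case: ifP => [|_]; last exact: vertex_subgroup1.
exact: vertex_subgroup_vertex.
Qed.

Lemma retraction_comp D E x : rho D (rho E x) = rho (D :&: E)%SET x.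
Proof.
move: x; apply: presented_morph_eq => [x y|x y|i] /=; rewrite ?retractionM //.
rewrite -/(v i).
by rewrite (retraction_vertex E) (retraction_vertex (D :&: E)%SET) inE andbC;
  case: ifP => _; rewrite ?retraction_vertex ?retraction1.
Qed.

Lemma vertex_subgroupI D E x : P D x -> P E x -> P (D :&: E)%SET x.
Proof.
move=> Dx Ex; rewrite -[x](retraction_id Dx) -{1}[x](retraction_id Ex).
by rewrite retraction_comp; apply: retraction_in.
Qed.

Lemma complete_commute D x y : complete e D -> P D x -> P D y -> commute x y.
Proof.
move=> cD; apply: vertex_subgroup_commute => i j iD jD.
have [->//|nij] := eqVneq i j.
by move: cD => /forall_inP/(_ i iD)/forall_inP/(_ j jD)/implyP/(_ nij)
  /vertex_commute.
Qed.

(** For a clique D the target W(D) is abelian, so conjugation becomes invisible. This is how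
    elements of clique subgroups are compared up to conjugacy. *)
Lemma retraction_conj D u x :
  complete e D -> rho D (u * x * u^-1) = rho D x.
Proof.
move=> cD; rewrite !retractionM retractionV; apply: conj_commute.
by apply: (complete_commute cD); apply: retraction_in.
Qed.

End GraphProduct.

Section NontrivialVertices.
Local Open Scope group_scope.
Variables (N : nat) (e : rel 'I_N) (m : 'I_N -> option nat).
Hypotheses (hm : order_map m).
Local Notation W := (graph_product e m).
Local Notation v := (vertex e m).
Local Notation P := (vertex_subgroup e m).
Implicit Types D E : {set 'I_N}.

Lemma order_map_gt1 i q : m i = Some q -> (1 < q)%N.
Proof.
move=> /hm[p [a [pp a0 ->]]]; apply: leq_trans (prime_gt1 pp) _.
by rewrite -{1}(expn1 p) leq_exp2l ?prime_gt1.
Qed.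

(** Detected in a finite cyclic quotient sending v_i to a generator and the other vertices to 1; for
    infinite order, Z/2 serves. *)
Lemma vertex_neq1 i : v i <> 1.
Proof.
pose q := if m i is Some q then q else 2.
have q1 : (1 < q)%N by rewrite /q; case E: (m i) => [k|] //;
  apply: order_map_gt1 E.
pose h j : 'I_(q.-2.+2) := if j == i then Zp1 else 1.
have [j k mj|j k _|f [fM fE]] := @graph_product_lift N e m 'I_(q.-2.+2) h.
- rewrite /h; case: eqP => [ji|_]; last exact: expg1n.
  have qk : q = k by rewrite /q -ji mj.
  have q2 : q.-2.+2 = q by case: (q) q1 => [|[|]].
  by apply: val_inj; rewrite Zp_expg /= -qk -[X in (_ * X)%N]q2 modnMl.
- exact: Zp_mulgC.
by move=> vi; have := fE i; rewrite /h eqxx vi morph_one.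
Qed.

End NontrivialVertices.

(** * Walls *)

(* The walls of type i are the cosets x W(S_i); [crossing i g x] in <v_i>     *)
(* is the total amount by which any path from 1 to g crosses x W(S_i), i.e.   *)
(* the sector of that wall containing g, that of 1 being normalised to 1.     *)
Section Crossing.
Local Open Scope group_scope.
Variables (N : nat) (e : rel 'I_N) (m : 'I_N -> option nat).
Hypothesis he : simplicial_graph e.
Local Notation W := (graph_product e m).
Local Notation v := (vertex e m).
Local Notation P := (vertex_subgroup e m).
Local Notation S := (star e).
Implicit Types (i j k : 'I_N) (D : {set 'I_N}) (x y g h s t : W).

Lemma star_sym i j : (i \in S j) = (j \in S i).
Proof. by rewrite !inE eq_sym; case: he => ->. Qed.

Lemma star_refl i : i \in S i. Proof. by rewrite inE eqxx. Qed.

Lemma star_commute i j : j \in S i -> commute (v i) (v j).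
Proof. by rewrite inE => /orP[/eqP->//|/vertex_commute]. Qed.

Lemma star_subgroup_commute i s t :
  P (S i) s -> P [set i]%SET t -> commute s t.
Proof.
apply: vertex_subgroup_commute => j k ji /set1P ->.
exact/commute_sym/star_commute.
Qed.

Lemma vertex_star i s : P [set i]%SET s -> P (S i) s.
Proof. by apply: vertex_subgroupS; rewrite finset.sub1set star_refl. Qed.

Lemma vertex_subgroupMl D s x : P D s -> P D (s * x) <-> P D x.
Proof.
move=> Ds; split=> [Dsx|]; last exact: vertex_subgroupM.
by rewrite -(mulKg s x); apply: vertex_subgroupM => //; apply: vertex_subgroupV.
Qed.

Lemma vertex_subgroupMr D s x : P D s -> P D (x * s) <-> P D x.
Proof.
move=> Ds; split=> [Dsx|Dx]; last exact: vertex_subgroupM.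
by rewrite -(mulgK s x); apply: vertex_subgroupM => //; apply: vertex_subgroupV.
Qed.

Lemma vertex_subgroupVE D x : P D x^-1 <-> P D x.
Proof. by split=> [/vertex_subgroupV|/vertex_subgroupV //]; rewrite invgK. Qed.

Lemma wreathX (a : W -> W) g n : (forall x, a (g^-1 * x) = a x) ->
  ((a, g) : wreath W W) ^+ n = (fun x => a x ^+ n, g ^+ n).
Proof.
move=> ag; elim: n => [//|n IHn]; rewrite expgS IHn.
congr (_, _); last by rewrite expgS.
by apply/funext => x /=; rewrite ag expgS.
Qed.

(** The relations of W hold in the wreath product: a vertex of S_i does not move the coset W(S_i),
    and at most one end of an edge is i. *)
Lemma crossing_exists i : exists c : W -> W -> W,
  [/\ forall g h x, c (g * h) x = c g x * c h (g^-1 * x),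
      forall x, c (v i) x = if `[< P (S i) x >] then v i else 1
    & forall j x, j != i -> c (v j) x = 1].
Proof.
pose a j x := if (j == i) && `[< P (S i) x >] then v i else 1.
have aS j s x : P (S i) s -> a j (s^-1 * x) = a j x.
  move=> /vertex_subgroupV Ds; rewrite /a.
  by rewrite (asbool_equiv_eq (vertex_subgroupMl x Ds)).
have [j q mj|j k ejk|f [fM fE]] :=
    @graph_product_lift N e m (wreath W W) (fun j => (a j, v j)).
- rewrite wreathX; last first.
    move=> x; have [ji|ji] := eqVneq j i; last by rewrite /a (negbTE ji).
    by apply: aS; apply: vertex_subgroup_vertex; rewrite ji star_refl.
  suff -> : (fun x => a j x ^+ q) = fun=> 1.
    by rewrite (vertex_order _ mj).
  apply/funext => x; rewrite /a.
  case: eqP mj => [-> /(vertex_order e) vi|_ _] /=; last exact: expg1n.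
  by case: ifP => _; rewrite ?vi ?expg1n.
- suff E : (fun x => a j x * a k ((v j)^-1 * x)) =
            (fun x => a k x * a j ((v k)^-1 * x)).
    exact: (congr2 pair E (vertex_commute m ejk)).
  have njk : j != k by apply: contraTneq ejk => ->; case: he => _ ->.
  apply/funext => x /=; have [ji|ji] := eqVneq j i.
    have ki : (k == i) = false by rewrite -ji eq_sym; apply/negbTE.
    rewrite (aS j (v k)).
      by rewrite /a ki /= mul1g mulg1.
    by apply: vertex_subgroup_vertex; rewrite inE -ji ejk orbT.
  have [ki|ki] := eqVneq k i.
    rewrite (aS k (v j)); first by rewrite /a (negbTE ji) /= mul1g mulg1.
    by apply: vertex_subgroup_vertex; rewrite star_sym inE -ki ejk orbT.
  by rewrite /a (negbTE ji) (negbTE ki).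
have f2 g : (f g).2 = g.
  move: g; apply: presented_morph_eq => [x y|x y|j] //=; first by rewrite fM.
  by rewrite -/(v j) fE.
exists (fun g => (f g).1); split.
- by move=> g h x; rewrite fM /= f2.
- by move=> x; rewrite fE /= /a eqxx.
- by move=> j x ji; rewrite fE /= /a (negbTE ji).
Qed.

Definition crossing i : W -> W -> W := projT1 (cid (crossing_exists i)).
Local Notation c := crossing.

Lemma crossingM i g h x : c i (g * h) x = c i g x * c i h (g^-1 * x).
Proof. by rewrite /crossing; case: cid => ? []. Qed.

Lemma crossing_vertex i x :
  c i (v i) x = if `[< P (S i) x >] then v i else 1.
Proof. by rewrite /crossing; case: cid => ? []. Qed.

Lemma crossing_other i j x : j != i -> c i (v j) x = 1.
Proof. by rewrite /crossing; case: cid => c /= [_ _]; apply. Qed.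

Lemma crossing1 i x : c i 1 x = 1.
Proof.
by have := crossingM i 1 1 x; rewrite invg1 !mul1g -{1}[c i 1 x]mulg1 => /mulgI.
Qed.

Lemma crossingV i g x : c i g^-1 x = (c i g (g * x))^-1.
Proof.
have := crossingM i g g^-1 (g * x); rewrite mulgV crossing1 mulKg => /esym.
by move/mulg1_eq => <-.
Qed.

(** The wreath product allows values anywhere in W; having them in the abelian <v_i> makes the order
    of crossings immaterial. *)
Lemma crossing_in i g x : P [set i]%SET (c i g x).
Proof.
move: g x; apply: graph_product_ind.
  split=> [x|g h Hg Hh x|g Hg x] /=.
  - rewrite crossing1; exact: vertex_subgroup1.
  - by rewrite crossingM; apply: vertex_subgroupM.
  - by rewrite crossingV; apply: vertex_subgroupV.
move=> j x /=; have [->|ji] := eqVneq j i.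
  rewrite crossing_vertex; case: ifP => _; last exact: vertex_subgroup1.
  by apply: vertex_subgroup_vertex; rewrite inE.
by rewrite crossing_other //; apply: vertex_subgroup1.
Qed.

Lemma crossing_commute i g x h y : commute (c i g x) (c i h y).
Proof. by apply: (@vertex_subgroup1_commute _ _ _ i); apply: crossing_in. Qed.

Lemma crossing_coset i g x s : P (S i) s -> c i g (x * s) = c i g x.
Proof.
move=> Ss; move: g x; apply: graph_product_ind.
  split=> [x|g h Hg Hh x|g Hg x] /=; first by rewrite !crossing1.
    by rewrite !crossingM mulgA Hg Hh.
  by rewrite !crossingV mulgA Hg.
move=> j x /=; have [->|ji] := eqVneq j i; last by rewrite !crossing_other.
by rewrite !crossing_vertex (asbool_equiv_eq (vertex_subgroupMr x Ss)).
Qed.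

Lemma crossing_coset1 i g s : P (S i) s -> c i g s = c i g 1.
Proof. by move=> Ss; rewrite -{1}(mul1g s) crossing_coset. Qed.

Lemma crossing_notin i D g x : i \notin D -> P D g -> c i g x = 1.
Proof.
move=> iD; move: g => g Dg; move: x.
apply: (vertex_subgroup_min (H := [set g | forall x, c i g x = 1])) Dg => /=.
  split=> [x|a b Ha Hb x|a Ha x] /=.
  - by rewrite crossing1.
  - by rewrite crossingM Ha Hb mulg1.
  - by rewrite crossingV Ha invg1.
by move=> j jD x; apply/crossing_other/(contraNneq _ iD) => <-.
Qed.

Lemma crossing_self i s x : P [set i]%SET s -> P (S i) x -> c i s x = s.
Proof.
move=> Ps Sx; rewrite crossing_coset1 //.
(* Membership in W(S_i) is carried along because the cocycle rule for a product a b evaluates b at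
   a^-1, which must again represent the wall W(S_i). *)
suff [] : P (S i) s /\ c i s 1 = s by [].
apply: (vertex_subgroup_min (H := [set s | P (S i) s /\ c i s 1 = s])) Ps.
  split=> [|a b /= [Sa Ha] [Sb Hb]|a /= [Sa Ha]] /=.
  - by split; [apply: vertex_subgroup1|rewrite crossing1].
  - split; first exact: vertex_subgroupM.
    by rewrite crossingM mulg1 (crossing_coset1 _ (vertex_subgroupV Sa)) Ha Hb.
  - split; first exact: vertex_subgroupV.
    by rewrite crossingV mulg1 crossing_coset1 ?Ha.
move=> j /set1P -> /=; split; first by apply: vertex_subgroup_vertex;
  apply: star_refl.
by rewrite crossing_vertex asboolT //; apply: vertex_subgroup1.
Qed.

Lemma crossing_letter i l x : c i (letter e m l) x =
  if (l.1 == i) && `[< P (S i) x >] then letter e m l else 1.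
Proof.
case: l => j b; rewrite /letter /=; have [->|ji] /= := eqVneq j i; last first.
  by case: b; rewrite ?crossingV crossing_other ?invg1.
case: b; rewrite ?crossingV crossing_vertex //.
have Sv : P (S i) (v i) by apply: vertex_subgroup_vertex; apply: star_refl.
by rewrite (asbool_equiv_eq (vertex_subgroupMl x Sv)); case: ifP;
  rewrite ?invg1.
Qed.

End Crossing.

(** * Conjugated walls, sectors and ping-pong *)

Section Conjugating.
Local Open Scope group_scope.
Variables (N : nat) (e : rel 'I_N) (m : 'I_N -> option nat).
Hypotheses (he : simplicial_graph e) (hm : order_map m).
Local Notation W := (graph_product e m).
Local Notation v := (vertex e m).
Local Notation P := (vertex_subgroup e m).
Local Notation S := (star e).
Local Notation c := (crossing he).
Implicit Types (i j k : 'I_N) (D : {set 'I_N}) (x y g h s t : W) (w : 'I_N ->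
  W).
Implicit Types f : aut W.

(** Count how x v_i = v_i x crosses the wall x W(S_i). The crossings of x cancel, so the step v_i
    from 1 crosses this wall nontrivially, and the wall must be W(S_i). *)
Lemma vertex_centraliser i x : commute x (v i) -> P (S i) x.
Proof.
move=> cxi; have Sv : P (S i) (v i).
  by apply: vertex_subgroup_vertex; apply: star_refl.
have := congr1 (fun z => c i z x) cxi; rewrite !crossingM mulVg.
rewrite crossing_vertex asboolT; last exact: vertex_subgroup1.
rewrite (_ : (v i)^-1 * x = x * (v i)^-1); last first.
  by apply: (mulgI (v i)); rewrite mulVKg mulgA -cxi mulgK.
rewrite crossing_coset; last exact: vertex_subgroupV.
rewrite -[RHS](crossing_commute he i x x (v i) x) => /mulgI.
by rewrite crossing_vertex; case: asboolP => // _ /(vertex_neq1 hm).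
Qed.

(* H_i = w_i W(S_i) is the wall of f(v_i) = w_i v_i w_i^-1; the walls of      *)
(* adjacent vertices meet.                                                    *)
Definition conjugators f w : Prop :=
  (forall i, f (v i) = w i * v i * (w i)^-1) /\
  (forall i j, j \in S i -> exists x,
     P (S i) ((w i)^-1 * x) /\ P (S j) ((w j)^-1 * x)).

Definition sector w i x : W := c i x (w i).

Lemma conjugators1 : conjugators 1 (fun=> 1).
Proof.
split=> [i|i j _]; first by rewrite aut_oneE; free_group.
by exists 1; rewrite invg1 mulg1; split; apply: vertex_subgroup1.
Qed.

Section Sectors.
Variables (f : aut W) (w : 'I_N -> W).
Hypothesis fw : conjugators f w.
Local Notation q := (sector w).

Lemma conjugators_in i s : P [set i]%SET s -> f s = w i * s * (w i)^-1.
Proof.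
move=> Ps; apply: (vertex_subgroup_morph_eq (@autM _ f) (@conj_morph _ (w i)) _
  Ps).
by move=> j /set1P ->; case: fw.
Qed.

Lemma sector_in i x : P [set i]%SET (q i x). Proof. exact: crossing_in. Qed.

Lemma crossing_wall i g x : P (S i) ((w i)^-1 * x) -> c i g x = c i g (w i).
Proof. by move=> Sx; rewrite -{1}(mulVKg (w i) x) crossing_coset. Qed.

(** The way out along y and the way back cross the same wall, as s lies in W(S_i), and cancel in
    <v_i>. *)
Lemma crossing_conj i s y : P (S i) s -> P [set i]%SET (c i s 1) ->
  c i (y * s * y^-1) y = c i s 1.
Proof.
move=> Ss Ps; rewrite -mulgA !crossingM mulVg mulg1 crossingV.
rewrite crossing_coset; last exact: vertex_subgroupV.
by rewrite mulgA (crossing_commute he i y y s 1) mulgK.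
Qed.

(** [f s] acts as the rotation by s about H_i. *)
Lemma sector_self i s x : P [set i]%SET s -> q i (f s * x) = s * q i x.
Proof.
move=> Ps; have Ss := vertex_star Ps.
have s1 : c i s 1 = s by apply: crossing_self => //; apply: vertex_subgroup1.
rewrite /q (conjugators_in Ps) crossingM crossing_conj ?s1 //.
congr (_ * _); rewrite (_ : _^-1 * _ = w i * s^-1); last by free_group.
by rewrite crossing_coset //; apply: vertex_subgroupV.
Qed.

(** For y on both H_i and H_j, [f s] is y s y^-1, which stabilises H_i without crossing it. *)
Lemma sector_adj i j s x :
  j \in S i -> j != i -> P [set j]%SET s -> q i (f s * x) = q i x.
Proof.
move=> ji nji Ps; have [y [yi yj]] := fw.2 _ _ ji.
have Ss : P (S i) s by apply: vertex_subgroupS Ps; rewrite finset.sub1set.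
have -> : f s = y * s * y^-1.
  have E : (w j)^-1 * y * s * ((w j)^-1 * y)^-1 = s.
    by apply: conj_commute; apply: star_subgroup_commute yj Ps.
  by rewrite (conjugators_in Ps) -{1}E; free_group.
rewrite /q -!(crossing_wall _ yi) crossingM crossing_conj //; last first.
  exact: crossing_in.
rewrite (crossing_notin _ _ _ Ps) ?mul1g ?inE 1?eq_sym //.
rewrite (_ : _^-1 * y = y * s^-1); last by free_group.
by rewrite crossing_coset //; apply: vertex_subgroupV.
Qed.

(** Moving along H_i uses no letter v_j, so H_i stays in one sector of H_j. *)
Lemma sector_wall i j u : j \notin S i -> P (S i) u -> q j (w i * u) = q j (w
  i).
Proof. by move=> ji Su; rewrite /q crossingM (crossing_notin _ _ ji Su) mulg1.
  Qed.

Lemma sector1 i : q i 1 = 1. Proof. exact: crossing1. Qed.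

Lemma sector_letter i x l :
    [/\ l.1 = i, P (S i) ((w i)^-1 * x) &
        q i (x * letter e m l) = q i x * letter e m l]
  \/ q i (x * letter e m l) = q i x.
Proof.
rewrite /q crossingM crossing_letter.
case: eqP => [li|_]; last by right; rewrite mulg1.
case: asboolP => Sx /=; last by right; rewrite mulg1.
left; split=> //; rewrite -vertex_subgroupVE.
by rewrite invgM invgK.
Qed.

Lemma letter_in l : P [set l.1]%SET (letter e m l).
Proof.
case: l => i b; have Pi : P [set i]%SET (v i).
  by apply: vertex_subgroup_vertex; rewrite inE.
by case: b => //; apply: vertex_subgroupV.
Qed.

(* Whenever a path to x crosses H_i, apply the inverse rotation to its        *)
(* remainder, which then stays on the side of 1 without the crossing.         *)
Lemma fold_short n i x : short n x ->
  exists k : nat, short k ((f (q i x))^-1 * x) /\ (k + (q i x != 1%g) <= n)%N.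
Proof.
elim: n x => [|n IHn] x.
  by move=> /short0 ->; exists 0; rewrite sector1 aut1 eqxx invg1 mulg1;
    split=> //; exists [::].
move=> /shortS_last[->|[l [y [/IHn[k [ky kn]] ->]]]].
  by exists 0; rewrite sector1 aut1 eqxx invg1 mulg1; split=> //; exists [::].
have [[li Sy ->]|->] := sector_letter i y l; last first.
  by exists k.+1; rewrite mulgA; split; [apply: short_rcons|rewrite addSn].
exists k; split; last first.
  by apply: leq_trans (_ : k + 1 <= _)%N; [rewrite leq_add2l; case: eqP|
     rewrite addn1 ltnS (leq_trans _ kn) ?leq_addr].
have Pl := @letter_in l; rewrite li in Pl.
set t := q i y in ky *; set z := (f t)^-1 * y in ky.
have Sz : P (S i) ((w i)^-1 * z).
  have -> : (w i)^-1 * z = t^-1 * ((w i)^-1 * y).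
    by rewrite /z (conjugators_in (@sector_in i y)) -/t; free_group.
  apply: vertex_subgroupM => //; apply: vertex_subgroupV; apply: vertex_star.
  exact: sector_in.
suff -> : (f (t * letter e m l))^-1 * (y * letter e m l) = z by [].
have E : commute ((w i)^-1 * z) (letter e m l) by apply: star_subgroup_commute
  Pl.
rewrite autM invgM (conjugators_in Pl).
have -> : (w i * letter e m l * (w i)^-1)^-1 * (f t)^-1 * (y * letter e m l) =
   w i * (letter e m l)^-1 * ((w i)^-1 * z * letter e m l) by rewrite /z;
     free_group.
by rewrite E; free_group.
Qed.

End Sectors.

(** Let x = l y with l a letter of type i. As x does not cross W(S_i), y crosses it by l^-1, and
    folding y there gives x back. Folding never lengthens, so x is as short as y. *)
Lemma crossing_trivial x : (forall i, c i x 1 = 1) -> x = 1.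
Proof.
have [n] := short_exists x; elim: n x => [|n IHn] x; first by move/short0.
move=> /shortS_head[//|[l [y [ny xE]]]] cx1.
have Pl := @letter_in l; have Sl := vertex_star Pl.
have cy : c l.1 y 1 = (letter e m l)^-1.
  have := cx1 l.1; rewrite xE crossingM mulg1 (crossing_coset1 he _
    (vertex_subgroupV Sl)).
  rewrite crossing_self //; last exact: vertex_subgroup1.
  by move/mulg1_eq.
have [k [kx kn]] := fold_short conjugators1 l.1 ny.
move: kx kn; rewrite /sector cy aut_oneE invgK -xE => kx kn.
apply: IHn cx1; apply: short_leq kx; apply: leq_trans kn; exact: leq_addr.
Qed.

(* Each of the walls lies on the side of 1 of the other, so that a path       *)
(* leaving the sector of 1 for one of them has to return before it can cross  *)
(* the other.                                                                 *)
Lemma sector_disjoint w i j x : j \notin S i ->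
  sector w i (w j) = 1 -> sector w j (w i) = 1 ->
  sector w i x = 1 \/ sector w j x = 1.
Proof.
move=> ji; have ij : i \notin S j by rewrite (star_sym he).
move=> qij qji; have [n] := short_exists x; elim: n x => [|n IHn] x.
  by move=> /short0 ->; rewrite sector1; left.
move=> /shortS_last[->|[l [y [/IHn qy ->]]]]; first by rewrite sector1; left.
have nij : i <> j by move=> E; rewrite E star_refl in ij.
have [[li Sy Ei]|->] := sector_letter w i y l.
  right; have [[lj _ _]|->] := sector_letter w j y l.
    by case: nij; rewrite -li -lj.
  by rewrite -(mulVKg (w i) y) sector_wall.
have [[lj Sy Ej]|-> //] := sector_letter w j y l.
by left; rewrite -(mulVKg (w j) y) sector_wall.
Qed.

Section PingPong.
Variables (f : aut W) (w : 'I_N -> W).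
Hypothesis fw : conjugators f w.
Hypothesis unseparated : forall i j, j \notin S i -> sector w i (w j) = 1.

(** [f g * r] sits among the H_i as g does among the walls W(S_i) through 1. Peel off a nontrivial
    crossing t of W(S_j), which shortens g: [f t] rotates about H_j and keeps the sectors of H_i for
    i adjacent to j; for the remaining i, being beyond H_j excludes being beyond H_i, in both
    arrangements. *)
Lemma ping_pong r : (forall i, sector w i r = 1) ->
  forall g i, sector w i (f g * r) = c i g 1.
Proof.
move=> r1 g; have [n] := short_exists g; elim: n g => [|n IHn] g.
  by move=> /short0 -> i; rewrite aut1 mul1g r1 crossing1.
move=> ng; have [g1|] := pselect (forall i, c i g 1 = 1).
  by rewrite (crossing_trivial g1) => i; rewrite aut1 mul1g r1 crossing1.
move=> /existsNP[j]; set t := c j g 1 => t1.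
have Pt : P [set j]%SET t by exact: crossing_in.
have [k [kx kn]] := fold_short conjugators1 j ng.
set h := t^-1 * g.
have gE : g = t * h by rewrite /h mulVKg.
have hq : forall i, sector w i (f h * r) = c i h 1.
  apply: IHn; apply: short_leq kx; move: kn; rewrite /sector -/t.
  by case: eqP => // _; rewrite addn1.
have fgr : f g * r = f t * (f h * r) by rewrite gE autM mulgA.
have gj : sector w j (f g * r) = c j g 1.
  rewrite fgr (sector_self fw) // hq.
  by have := sector_self conjugators1 h Pt; rewrite /sector aut_oneE -gE => ->.
move=> i; have [->//|nij] := eqVneq i j.
have [ji|ji] := boolP (j \in S i).
  rewrite fgr (sector_adj fw _ ji) ?hq // 1?eq_sym //.
  have := sector_adj conjugators1 h ji _ Pt.
  by rewrite /sector aut_oneE -gE eq_sym => ->.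
have ij : i \notin S j by rewrite (star_sym he).
have [->|] := sector_disjoint (f g * r) ji (unseparated ji) (unseparated ij).
  have s1 k' : sector (fun=> 1) k' 1 = 1 by rewrite sector1.
  by have [|] := sector_disjoint (w := fun=> 1) g ji (s1 _) (s1 _);
    rewrite /sector.
by rewrite gj.
Qed.

Lemma unseparated_trivial : f = 1.
Proof.
have r1 r : (forall i, sector w i r = 1) -> r = 1.
  (* This g, available because f is onto, satisfies f(g) r = 1, so g crosses no wall through 1 and
     is trivial. *)
  move=> qr; have := ping_pong qr; move=> /(_ (f^-1 r)^-1) H.
  have : (f^-1 r)^-1 = 1.
    apply: crossing_trivial => i.
    by rewrite -H autV autVK mulVg sector1.
  by move=> /(congr1 f); rewrite autV autVK aut1 => /(congr1 inv);
    rewrite invgK invg1.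
apply/autP/presented_morph_eq; [exact: autM|exact: autM|move=> i].
rewrite -/(v i) aut_oneE fw.1; apply: conj_commute.
apply: (@star_subgroup_commute N e m i); last first.
  by apply: vertex_subgroup_vertex; rewrite inE.
(* Some H_k separates v_i from 1. Only k = i is possible, and the step v_i crosses H_i only if w_i
   is in W(S_i). *)
have [k] : exists k, sector w k (v i) <> 1.
  by apply/existsNP => /r1; apply: vertex_neq1.
have [->|ki] := eqVneq k i; last by rewrite /sector crossing_other // eq_sym.
by rewrite /sector crossing_vertex; case: asboolP.
Qed.

End PingPong.

End Conjugating.

(** * Connected components *)

Section Components.
Variables (N : nat) (e : rel 'I_N).
Hypothesis he : simplicial_graph e.
Implicit Types (D K : {set 'I_N}) (i j k : 'I_N).

Lemma component_exists D j : j \in D -> exists2 K, is_component e D K & j \in K.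
Proof.
by move=> jD; eexists; [exists j => //|rewrite inE jD connect0].
Qed.

Lemma component_sub D K k : is_component e D K -> k \in K -> k \in D.
Proof. by move=> [x xD ->]; rewrite inE => /andP[]. Qed.

Lemma component_closed D K j k :
  is_component e D K -> j \in K -> e j k -> k \in D -> k \in K.
Proof.
move=> [x xD ->]; rewrite !inE => /andP[jD xj] ejk kD; rewrite kD /=.
by apply: connect_trans xj (connect1 _); rewrite /= jD kD.
Qed.

Lemma component_constant (T : Type) (phi : 'I_N -> T) D K :
    is_component e D K ->
    (forall j k, j \in D -> k \in D -> e j k -> phi j = phi k) ->
  forall j k, j \in K -> k \in K -> phi j = phi k.
Proof.
move=> [x xD ->] phiE.
suff H k : connect [rel u v | [&& u \in D, v \in D & e u v]] x k -> phi x = phi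
  k.
  by move=> j k; rewrite !inE => /andP[_ /H <-] /andP[_ /H <-].
move=> /connectP[p + ->]; elim: p x {xD} => //= y p IHp x /andP[/and3P[xD yD
  exy]].
by move=> /IHp <-; apply: phiE.
Qed.

End Components.

(** * Clique-conjugating automorphisms and their generation *)

Section CliqueConjugating.
Local Open Scope group_scope.
Variables (N : nat) (e : rel 'I_N) (m : 'I_N -> option nat).
Hypotheses (he : simplicial_graph e) (hm : order_map m).
Local Notation W := (graph_product e m).
Local Notation v := (vertex e m).
Local Notation P := (vertex_subgroup e m).
Local Notation S := (star e).
Implicit Types (i j k : 'I_N) (D K : {set 'I_N}) (x y s t : W) (w : 'I_N -> W).
Implicit Types f g : aut W.

Definition clique_conjugating : set (aut W) :=
  [set f : aut W | forall D, complete e D ->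
    exists u, forall i, i \in D -> f (v i) = u * v i * u^-1].

Lemma complete_edge i j : j \in S i -> complete e [set i; j]%SET.
Proof.
move=> ji; have [esym _] := he.
apply/forall_inP => a /set2P[] ->; apply/forall_inP => b /set2P[] ->;
  apply/implyP; rewrite ?eqxx // => nij; move: ji; rewrite inE.
- by rewrite eq_sym (negbTE nij).
- by rewrite (negbTE nij) esym.
Qed.

(** A common conjugator u for an edge lies on both walls, because w_k^-1 u centralises v_k. *)
Lemma clique_conjugating_conjugators f w : clique_conjugating f ->
  (forall i, f (v i) = w i * v i * (w i)^-1) -> conjugators f w.
Proof.
move=> cf fw; split=> // i j /complete_edge/cf[u fu]; exists u.
have C k : f (v k) = u * v k * u^-1 -> P (S k) ((w k)^-1 * u).
  rewrite fw => E; apply: (vertex_centraliser he hm); apply: commute_conj.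
  have -> : (w k)^-1 * u * v k * ((w k)^-1 * u)^-1 = (w k)^-1 * (u * v k *
    u^-1) * w k.
    by free_group.
  by rewrite -E; free_group.
by split; apply: C; apply: fu; rewrite !inE eqxx ?orbT.
Qed.

Lemma clique_conjugating_vertex f :
  clique_conjugating f -> exists w, forall i, f (v i) = w i * v i * (w i)^-1.
Proof.
move=> cf; suff /choice[w fw] : forall i, exists u, f (v i) = u * v i * u^-1.
  by exists w.
move=> i; have [|u fu] := cf [set i; i]%SET;
  first by apply/complete_edge/star_refl.
by exists u; apply: fu; rewrite !inE eqxx.
Qed.

Lemma clique_conjugating_subgroup : is_subgroup clique_conjugating.
Proof.
split.
- by move=> D _; exists 1 => i _; rewrite aut_oneE; free_group.
- move=> f g cf cg D cD; have [u fu] := cf D cD; have [u' gu] := cg D cD.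
  by exists (f u' * u) => i iD; rewrite aut_mulE gu // autJ fu //; free_group.
- move=> f cf D cD; have [u fu] := cf D cD.
  exists (f^-1 u)^-1 => i iD; apply: (aut_inj (f := f)).
  by rewrite autVK !autM !autV autVK fu //; free_group.
Qed.

Lemma inner_clique_conjugating u : clique_conjugating (inner_aut u).
Proof. by move=> D _; exists u. Qed.

(** A partial conjugation by an arbitrary t: a power of v_i in the descent, an element of W(Delta_i)
    when conjugating by Aut^1 W. *)
Definition twist K t f : Prop :=
  forall k, f (v k) = if k \in K then t * v k * t^-1 else v k.

Lemma twist_clique_conjugating i K t f : is_component e (~: S i)%SET K ->
  P [set i]%SET t -> twist K t f -> clique_conjugating f.
Proof.
move=> cK Pt tf D cD.
have [[k [kD kK]]|nK] := pselect (exists k, k \in D /\ k \in K); last first.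
  exists 1 => j jD; rewrite tf; case: ifP => [jK|_]; last by free_group.
  by case: nK; exists j.
exists t => j jD; rewrite tf; case: ifP => // /negbT jK.
have ji : j \in S i.
  apply: contraNT jK => ji; have [->//|njk] := eqVneq j k.
  apply: component_closed cK kK _ _; last by rewrite inE.
  move: cD => /forall_inP/(_ k kD)/forall_inP/(_ j jD)/implyP; apply.
  by rewrite eq_sym.
apply/esym/conj_commute/commute_sym; apply: star_subgroup_commute Pt.
exact: vertex_subgroup_vertex.
Qed.

Lemma twist_fix K t f D x :
  twist K t f -> (forall k, k \in D -> k \notin K) -> P D x -> f x = x.
Proof.
move=> tf DK; apply: (vertex_subgroup_morph_eq (g := id)) => [|//|k kD].
  exact: autM.
by rewrite tf (negbTE (DK k kD)).
Qed.

Lemma twist_unique K t f g : twist K t f -> twist K t g -> f = g.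
Proof.
move=> tf tg; apply/autP/presented_morph_eq; [exact: autM|exact: autM|move=> k].
by rewrite -/(v k) tf tg.
Qed.

(** As D misses K, twists by elements of W(D) fix W(D), so composing them multiplies the elements t;
    vertices therefore suffice. *)
Lemma twist_exists (L : set (aut W)) D K t : is_subgroup L ->
    (forall k, k \in D -> k \notin K) ->
    (forall i, i \in D -> exists2 f, L f & is_partial_conj i K f) ->
  P D t -> exists2 f, L f & twist K t f.
Proof.
move=> [L1 LM LV] DK DL Dt.
suff [] : P D t /\ exists2 f, L f & twist K t f by [].
apply: (vertex_subgroup_min (H := [set t | P D t /\ exists2 f, L f & twist K t
  f])) Dt.
  split=> /= [|a b [Da [f Lf tf]] [Db [g Lg tg]]|a [Da [f Lf tf]]].
  - split; first exact: vertex_subgroup1.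
    by exists 1 => // k; rewrite aut_oneE; case: ifP => _; [free_group|].
  - split; first exact: vertex_subgroupM.
    exists (g * f); first exact: LM.
    move=> k; rewrite aut_mulE tf; case: ifP => kK; last by rewrite tg kK.
    by rewrite autJ tg kK (twist_fix tg DK Da); free_group.
  - split; first exact: vertex_subgroupV.
    exists f^-1; first exact: LV.
    move=> k; apply: (aut_inj (f := f)); rewrite autVK.
    case: ifP => kK; last by rewrite tf kK.
    by rewrite !autM !autV tf kK (twist_fix tf DK Da); free_group.
move=> i iD /=; split; first exact: vertex_subgroup_vertex.
by have [f Lf tf] := DL i iD; exists f.
Qed.

(* A partial conjugation moves the walls of a component K of G \ S_i lying    *)
(* beyond H_i closer to 1; when no wall lies beyond another, f = 1.           *)
Lemma clique_conjugating_generated (L : set (aut W)) f : is_subgroup L ->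
    (forall i K, is_component e (~: S i)%SET K ->
       exists2 g, L g & is_partial_conj i K g) ->
  clique_conjugating f -> L f.
Proof.
move=> sL PL cf; have [L1 LM LV] := sL.
have [w fw] := clique_conjugating_vertex cf.
have [d dw] := choice (fun i => short_exists (w i)).
have [n] := ubnP (\sum_i d i)%N.
elim: n f cf w fw d dw => // n IHn f cf w fw d dw dn.
have fwc := clique_conjugating_conjugators cf fw.
have [un|] := pselect (forall i j, j \notin S i -> sector he w i (w j) = 1).
  by rewrite (unseparated_trivial hm fwc un).
move=> /existsNP[i /existsNP[j /not_implyP[ji]]]; set t := sector _ _ _ _ => t1.
have Pt : P [set i]%SET t by exact: sector_in.
have [|K cK jK] := @component_exists N e (~: S i)%SET j; first by rewrite inE.
have KS k : k \in K -> k \notin S i by move=> /(component_sub cK); rewrite inE.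
(* The walls of adjacent vertices of K share a point, and each lies in one sector of H_i. *)
have Kt k : k \in K -> sector he w i (w k) = t.
  move=> kK; apply: (component_constant (phi := fun k =>
    sector he w i (w k)) cK) => //.
  move=> a b; rewrite !inE => ai bi eab.
  have [|x [xa xb]] := fwc.2 a b; first by rewrite inE eab orbT.
  have ia : i \notin S a by rewrite (star_sym he) inE.
  have ib : i \notin S b by rewrite (star_sym he) inE.
  by rewrite -(sector_wall he w ia xa) -(sector_wall he w ib xb) !mulVKg.
have iK k : k \in [set i]%SET -> k \notin K.
  by move=> /set1P ->; apply/negP => /KS; rewrite star_refl.
have [||g Lg tg] := twist_exists (t := t^-1) sL iK.
- by move=> _ /set1P ->; apply: PL.
- exact: vertex_subgroupV.
have cg := twist_clique_conjugating cK (vertex_subgroupV Pt) tg.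
have Lfg : L (f * g); last by rewrite -(mulgK g f); apply: LM => //; apply: LV.
have [_ cM _] := clique_conjugating_subgroup.
have dK k : k \in K -> (0 < d k)%N /\ short (d k).-1 ((f t)^-1 * w k).
  move=> kK; have [b [bk]] := fold_short he fwc i (dw k).
  rewrite (Kt k kK) in bk *.
  have -> /= : (t != 1) = true by apply/eqP.
  rewrite addn1 => bd; split; first exact: leq_trans bd.
  by apply: short_leq bk; rewrite -ltnS prednK // (leq_trans _ bd).
(* These conjugators of f g are the folds at H_i of the old ones, strictly shorter on K. *)
pose w' k := if k \in K then (f t)^-1 * w k else w k.
pose d' k := if k \in K then (d k).-1 else d k.
apply: (IHn _ (cM _ _ cf cg) w' _ d').
- move=> k; rewrite aut_mulE tg /w'; case: ifP => kK; last exact: fw.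
  by rewrite autJ autV fw; free_group.
- by move=> k; rewrite /w' /d'; case: ifP => // /dK[].
apply: leq_trans (_ : \sum_i d i <= n)%N; last by rewrite -ltnS.
rewrite (bigD1 j) //= [ltnRHS](bigD1 j) //= -addSn leq_add //.
  by rewrite /d' jK prednK //; case: (dK j jK).
by apply: leq_sum => k _; rewrite /d'; case: ifP => // _; apply: leq_pred.
Qed.

End CliqueConjugating.

(** * The subgroups Inn W and Out^0 W *)

Section OuterZero.
Local Open Scope group_scope.
Variables (N : nat) (e : rel 'I_N) (m : 'I_N -> option nat).
Hypotheses (he : simplicial_graph e) (hm : order_map m).
Local Notation W := (graph_product e m).
Local Notation v := (vertex e m).
Local Notation P := (vertex_subgroup e m).
Local Notation S := (star e).
Local Notation Out0 := (Out0 e m).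
Local Notation rho := (@retraction N e m).
Implicit Types (i j k : 'I_N) (D K U : {set 'I_N}) (x y s t : W) (f g : aut W).

Lemma Out0_subgroup : is_subgroup Out0.
Proof. exact: generated_subgroupP. Qed.

Lemma component_notin i K : is_component e (~: S i)%SET K -> i \notin K.
Proof.
by move=> cK; apply/negP => /(component_sub cK); rewrite inE star_refl.
Qed.

Lemma partial_conj_clique_conjugating i K f :
  is_component e (~: S i)%SET K -> is_partial_conj i K f ->
  clique_conjugating f.
Proof.
move=> cK; apply: twist_clique_conjugating cK _.
by apply: vertex_subgroup_vertex; rewrite inE.
Qed.

Lemma Out0_clique_conjugating : Out0 `<=` clique_conjugating (m := m).
Proof.
apply: generated_min => [|f [i [K [j [cK _ _ _]]]]].
  exact: clique_conjugating_subgroup.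
exact: partial_conj_clique_conjugating.
Qed.

Lemma partial_conj_inv i K f k : i \notin K -> is_partial_conj i K f ->
  f^-1 (v k) = if k \in K then (v i)^-1 * v k * v i else v k.
Proof.
move=> iK tf; apply: (aut_inj (f := f)); rewrite autVK.
case: ifP => kK; last by rewrite tf kK.
by rewrite !autM autV !tf kK (negbTE iK); free_group.
Qed.

Lemma partial_conj_fix i K f : i \notin K -> is_partial_conj i K f ->
  f^-1 (v i) = v i.
Proof. by move=> iK tf; rewrite (partial_conj_inv i iK tf) (negbTE iK). Qed.

(** U is a union of components missing j0; splitting them off one by one leaves generators from
    P^0. *)
Lemma partial_conj_union_Out0 i j0 U f :
    j0 \notin S i -> (forall k, k \notin S i -> (j0 <= k)%N) ->
    (forall k, k \in U -> k \notin S i) ->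
    (forall j k, j \in U -> e j k -> k \notin S i -> k \in U) ->
  j0 \notin U -> is_partial_conj i U f -> Out0 f.
Proof.
move=> j0i j0min; have [O1 OM OV] := Out0_subgroup.
have [n] := ubnP #|U|; elim: n U f => // n IHn U f Un US Ucl j0U tf.
have [U0|/set0Pn[x xU]] := eqVneq U finset.set0.
  suff -> : f = 1 by [].
  apply: twist_unique tf _ => k; rewrite U0 inE; exact: aut_oneE.
have iU : i \notin U by apply/negP => /US; rewrite star_refl.
have [|K cK xK] := @component_exists N e (~: S i)%SET x;
  first by rewrite inE US.
have [esym _] := he.
have KU : K \subset U.
  apply/fintype.subsetP => k kK.
  suff <- : (x \in U) = (k \in U) by [].
  apply: (component_constant (phi := fun k => k \in U) cK _ xK kK) => a b.
  rewrite !finset.in_setC => ai bi eab; apply/idP/idP => [aU|bU];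
    first exact: Ucl aU eab bi.
  by apply: Ucl bU _ ai; rewrite esym.
have [g tg] := partial_conj_exists m he cK.
have iK := component_notin cK.
rewrite -(mulVKg g f); apply: OM.
  apply: generated_sub; exists i, K, j0; split=> //.
  by apply: contraNN j0U; apply: (fintype.subsetP KU).
apply: (IHn (U :\: K)%SET).
- apply: leq_trans (proper_card _) Un; rewrite finset.properEneq
    finset.subsetDl andbT.
  by apply: contraTneq xU => <-; rewrite inE xK.
- by move=> k /finset.setDP[/US].
- move=> j k /finset.setDP[jU jK] ejk ki; rewrite inE (Ucl j) // andbT.
  apply: contraNN jK => kK; apply: component_closed cK kK _ _;
    last by rewrite inE US.
  by rewrite esym.
- by rewrite inE (negbTE j0U) andbF.
- move=> k; rewrite aut_mulE tf inE; case: ifP => kU; last first.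
    by rewrite andbF (partial_conj_inv k iK tg) ifN //;
       apply: contraFN kU; apply: (fintype.subsetP KU).
  rewrite andbT autJ (partial_conj_fix iK tg) (partial_conj_inv k iK tg).
  by case: ifP => kK //=; free_group.
Qed.

Lemma component_min i K : is_component e (~: S i)%SET K ->
  exists2 j, j \notin S i & forall k, k \notin S i -> (j <= k)%N.
Proof.
move=> [x]; rewrite inE => xS _.
by case: (arg_minnP (P := fun k => k \notin S i) (fun k => k : nat) xS) =>
  j jS jmin; exists j.
Qed.

Lemma partial_conj_Inn_Out0 i K f :
  is_component e (~: S i)%SET K -> is_partial_conj i K f ->
  mul_set (Inn W) Out0 f.
Proof.
move=> cK tf; have [O1 OM OV] := Out0_subgroup.
have [j0 j0i j0min] := component_min cK; have [esym _] := he.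
have [j0K|j0K] := boolP (j0 \in K); last first.
  exists 1, f; split; last by rewrite mul1g.
    by case: (Inn_subgroup W).
  by apply: generated_sub; exists i, K, j0.
(* When j0 is in K, this g is the partial conjugation over all the other components, none of which
   contains j0. *)
pose g := f^-1 * inner_aut (v i).
exists (inner_aut (v i)), g^-1; split; first by exists (v i).
  apply: OV; apply: (partial_conj_union_Out0 (i := i) (U := ~: S i :\: K)%SET)
    j0min _ _ _ _ => //.
  - by move=> k /finset.setDP[]; rewrite inE.
  - move=> j k /finset.setDP[]; rewrite inE => ji jK ejk ki.
    rewrite finset.in_setD finset.in_setC ki andbT; apply: contraNN jK => kK.
    by apply: component_closed cK kK _ _; [rewrite esym|rewrite inE].
  - by rewrite inE j0K.
  - have iK := component_notin cK.
    move=> k; rewrite aut_mulE inner_autE autJ (partial_conj_fix iK tf).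
    rewrite (partial_conj_inv k iK tf) finset.in_setD finset.in_setC andbC.
    case: (boolP (k \in K)) => kK; rewrite ?andbF; first by free_group.
    rewrite andbT; case: ifPn => // /negPn ki.
    by apply: conj_commute; apply: star_commute.
by rewrite /g invgM invgK mulVKg.
Qed.

Lemma Inn_Out0_subgroup : is_subgroup (mul_set (Inn W) Out0).
Proof.
apply: mul_set_subgroup; [exact: Inn_subgroup|exact: Out0_subgroup|].
by move=> f g _; apply: Inn_normal.
Qed.

Lemma clique_conjugating_Inn_Out0 f :
  clique_conjugating f -> mul_set (Inn W) Out0 f.
Proof.
apply: (clique_conjugating_generated he hm Inn_Out0_subgroup) => i K cK.
have [g tg] := partial_conj_exists m he cK; exists g => //.
exact: partial_conj_Inn_Out0 tg.
Qed.

(** Vertices outside U go to conjugates of themselves, which [rho U] kills; so f induces an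
    endomorphism of W(U). *)
Lemma retraction_clique_conjugating U f x : clique_conjugating f ->
  rho U (f (rho U x)) = rho U (f x).
Proof.
move=> /(clique_conjugating_vertex he)[w fw]; move: x.
apply: presented_morph_eq => [x y|x y|k];
  rewrite ?retractionM ?autM ?retractionM //.
rewrite -/(v k) retraction_vertex; case: ifP => // kU.
rewrite aut1 retraction1 fw !retractionM retraction_vertex kU retractionV.
by free_group.
Qed.

Lemma Inn_Out0_trivial f : Inn W f -> Out0 f -> f = 1.
Proof.
move=> /InnP[x ->] Of.
(* [T n] is the intersection of the S_j with j < n, so W(T N) is central. *)
pose T n : {set 'I_N} := [set k | [forall j : 'I_N, (j < n)%N ==> (k \in S
  j)]]%SET.
suff H n : (n <= N)%N -> P (T n) x.
  apply/autP/presented_morph_eq; [exact: autM|exact: autM|move=> k].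
  rewrite -/(v k) inner_autE aut_oneE; apply: conj_commute.
  apply: (@star_subgroup_commute _ _ _ k); last first.
    by apply: vertex_subgroup_vertex; rewrite inE.
  apply: vertex_subgroupS (H N (leqnn N)); apply/fintype.subsetP => i.
  by rewrite inE => /forallP/(_ k); rewrite ltn_ord.
elim: n => [|n IHn] nN.
  apply: (graph_product_ind (vertex_subgroupP _ _ _)) => k.
  by apply: vertex_subgroup_vertex; rewrite inE; apply/forallP.
have Tx := IHn (ltnW nN); pose j0 := Ordinal nN.
pose U := (j0 |: T n)%SET.
suff xj0 : rho U (x * v j0 * x^-1) = v j0.
  have TU : T n \subset U by exact: finset.subsetUr.
  have Sx : P (S j0) x.
    apply: (vertex_centraliser he hm); apply: commute_conj.
    rewrite -[RHS]xj0 !retractionM retractionV retraction_vertex setU11.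
    by rewrite retraction_id //; apply: vertex_subgroupS Tx.
  apply: vertex_subgroupS (vertex_subgroupI Tx Sx).
  apply/fintype.subsetP => k; rewrite !inE => /andP[/forallP kT kj0].
  apply/forallP => j; apply/implyP; rewrite ltnS leq_eqVlt => /orP[/eqP jn|jn].
    by rewrite (_ : j = j0) ?inE //; apply: val_inj.
  by move: (kT j); rewrite jn.
have [CC1 CCM CCV] := @clique_conjugating_subgroup N e m.
pose A : set (aut W) := [set f | clique_conjugating f /\ rho U (f (v j0)) = v
  j0].
have rj0 : rho U (v j0) = v j0 by rewrite retraction_vertex setU11.
suff [_ //] : A (inner_aut x).
apply: (generated_min (H := A)) Of.
  split=> [|g h [cg gj] [ch hj]|g [cg gj]]; split=> //;
    try by [apply: CCM|apply: CCV].
    by rewrite aut_mulE -retraction_clique_conjugating // hj gj.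
  rewrite -{1}gj retraction_clique_conjugating; last exact: CCV.
  by rewrite autK.
move=> g [i [K [j [cK ji jmin jK tg]]]]; split.
  exact: partial_conj_clique_conjugating tg.
rewrite tg; case: ifP => // j0K.
(* As j0 is outside S_i and in K, the minimal j precedes j0. Since i is not in S_j, it is not in
   [T n], and [rho U] kills v_i. *)
have iU : i \notin U.
  rewrite in_setU1 negb_or; apply/andP; split.
    by apply: contraTneq j0K => <-; apply: component_notin.
  apply: contraNN jK; rewrite inE => /forallP/(_ j)/implyP jT.
  have j0i : j0 \notin S i by have := component_sub cK j0K; rewrite inE.
  have := jmin j0 j0i; rewrite leq_eqVlt => /orP[/eqP /= jn|/jT].
    by rewrite (_ : j = j0) //; apply: val_inj.
  by rewrite (star_sym he) (negbTE ji).
by rewrite !retractionM retractionV retraction_vertex (negbTE iU) rj0;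
  free_group.
Qed.

End OuterZero.

(** * The subgroups Aut^* W and Aut^1 W *)

(** A choice function for R is injective on the finite set M, hence onto. *)
Lemma finite_matching (T : finType) (M : {set T}) (R : T -> T -> Prop) :
    (forall x, x \in M -> exists2 y, y \in M & R x y) ->
    (forall x x' y, x \in M -> x' \in M -> R x y -> R x' y -> x = x') ->
  forall y, y \in M -> exists2 x, x \in M & R x y.
Proof.
move=> Rex Rinj y yM.
have /choice[s sP] : forall x, exists z, x \in M -> z \in M /\ R x z.
  move=> x; have [xM|_] := boolP (x \in M); last by exists x.
  by have [z zM xz] := Rex x xM; exists z.
have sinj : {in M &, injective s}.
  move=> x x' xM x'M ss; have [_ xs] := sP x xM; have [_ xs'] := sP x' x'M.
  by apply: (Rinj x x' (s x)) => //; rewrite ss.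
have sM : (s @: M = M)%SET.
  apply/eqP; rewrite eqEcard card_in_imset // leqnn andbT.
  by apply/fintype.subsetP => _ /imsetP[x /sP[sxM _] ->].
move: yM; rewrite -{1}sM => /imsetP[x xM ->].
by exists x => //; case: (sP x xM).
Qed.

Section AutStar.
Local Open Scope group_scope.
Variables (N : nat) (e : rel 'I_N) (m : 'I_N -> option nat).
Hypotheses (he : simplicial_graph e) (hm : order_map m).
Local Notation W := (graph_product e m).
Local Notation v := (vertex e m).
Local Notation P := (vertex_subgroup e m).
Local Notation S := (star e).
Local Notation Out0 := (Out0 e m).
Local Notation AutStar := (AutStar e m).
Local Notation Aut1 := (Aut1 e m).
Local Notation rho := (@retraction N e m).
Implicit Types (i j k : 'I_N) (D E K : {set 'I_N}) (x y u : W) (f g : aut W).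

Lemma max_complete_complete D : max_complete e D -> complete e D.
Proof. by move=> /maxsetP[]. Qed.

Lemma max_complete_exists D : complete e D ->
  exists2 E, max_complete e E & D \subset E.
Proof. by move=> /maxset_exists[E mE DE]; exists E. Qed.

Lemma max_complete_vertex i : exists2 D, max_complete e D & i \in D.
Proof.
have [D mD iD] := max_complete_exists (complete_edge he (star_refl e i)).
by exists D => //; apply: (fintype.subsetP iD); rewrite !inE eqxx.
Qed.

Definition maps_onto f u D E : Prop :=
  forall x, P D x <-> P E (u^-1 * f x * u).

Lemma maps_ontoP f u D E :
  f @` P D = conj_subgroup u (P E) <-> maps_onto f u D E.
Proof.
split=> [fD x|fDE].
  split=> [Dx|Ex].
    have : (conj_subgroup u (P E)) (f x) by rewrite -fD; exists x.
    by move=> [y Ey <-]; rewrite (_ : _ * u = y) //; free_group.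
  have : (f @` P D) (f x).
    by rewrite fD; exists (u^-1 * f x * u) => //; free_group.
  by move=> [y Dy /(aut_inj (f := f)) <-].
apply/seteqP; split=> [_ [x Dx <-]|_ [y Ey <-]].
  by exists (u^-1 * f x * u); [apply/fDE|free_group].
exists (f^-1 (u * y * u^-1)); last by rewrite autVK.
by apply/fDE; rewrite autVK (_ : _ * u = y) //; free_group.
Qed.

Lemma maps_onto_id D : maps_onto 1 1 D D.
Proof. by move=> x; rewrite aut_oneE invg1 mul1g mulg1. Qed.

Lemma maps_onto_comp f g u u' D D' E :
  maps_onto g u' D D' -> maps_onto f u D' E -> maps_onto (f * g) (f u' * u) D E.
Proof.
move=> gD fD x; rewrite (gD x) fD !autM autV aut_mulE invgM.
by rewrite !mulgA.
Qed.

Lemma maps_onto_inv f u D E :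
  maps_onto f u D E -> maps_onto f^-1 (f^-1 u)^-1 E D.
Proof.
by move=> fD y; rewrite fD !autM !autV !autVK; free_group.
Qed.

(** After retracting onto W(E), a vertex of D outside E would be trivial. *)
Lemma maps_onto_id_sub u D E :
  complete e E -> maps_onto 1 u D E -> D \subset E.
Proof.
move=> cE uDE; apply/fintype.subsetP => i iD.
have := (uDE (v i)).1 (vertex_subgroup_vertex iD); rewrite aut_oneE => Ei.
have := retraction_id Ei; rewrite -{2}(invgK u) retraction_conj //.
rewrite retraction_vertex; case: ifP => // _ /(congr1 (fun x => u * x * u^-1)).
by free_group => /esym/(vertex_neq1 hm).
Qed.

Lemma maps_onto_inj f u u' D D' E : complete e D -> complete e D' ->
  maps_onto f u D E -> maps_onto f u' D' E -> D = D'.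
Proof.
suff H u1 u2 D1 D2 : complete e D2 -> maps_onto f u1 D1 E ->
    maps_onto f u2 D2 E -> D1 \subset D2.
  move=> cD cD' fD fD'; apply/eqP; rewrite finset.eqEsubset.
  by rewrite (H _ _ _ _ cD' fD fD') (H _ _ _ _ cD fD' fD).
move=> cD2 f1 /maps_onto_inv f2; have := maps_onto_comp f1 f2.
by rewrite mulVg; apply: maps_onto_id_sub.
Qed.

(* Aut^* W and Aut^1 W are the cases Q = setT and Q = [set 1]. *)
Definition permutes_cliques (Q : set W) : set (aut W) :=
  [set f : aut W | forall D, max_complete e D ->
    exists E u, [/\ max_complete e E, Q u & maps_onto f u D E]].

Lemma AutStarE : AutStar = permutes_cliques setT.
Proof.
apply/seteqP; split=> f fP D /fP.
  by move=> [u [E [mE /maps_ontoP]]]; exists E, u.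
by move=> [E [u [mE _ /maps_ontoP]]]; exists u, E.
Qed.

Lemma Aut1E : Aut1 = permutes_cliques [set 1].
Proof.
have conj1 E : conj_subgroup 1 (P E) = P E.
  apply/seteqP; split=> [_ [y Ey <-]|y Ey]; first by rewrite invg1 mul1g mulg1.
  by exists y; rewrite // invg1 mul1g mulg1.
apply/seteqP; split=> f fP D /fP.
  by move=> [E [mE fE]]; exists E, 1; split=> //; apply/maps_ontoP;
    rewrite conj1.
by move=> [E [_ [mE -> /maps_ontoP]]]; rewrite conj1; exists E.
Qed.

(** The injection induced on the finite set of maximal cliques is a permutation; closure under
    inverses rests on this. *)
Lemma permutes_cliques_onto Q f : permutes_cliques Q f ->
  forall E, max_complete e E ->
  exists D u, [/\ max_complete e D, Q u & maps_onto f u D E].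
Proof.
move=> fQ E mE.
have [|||D] := @finite_matching _ [set D | max_complete e D]%SET
  (fun D E => exists2 u, Q u & maps_onto f u D E) _ _ E; rewrite ?inE //.
- move=> D; rewrite inE => /fQ[D' [u [mD' Qu fu]]].
  by exists D'; [rewrite inE|exists u].
- move=> D D' E'; rewrite !inE => /max_complete_complete cD.
  move=> /max_complete_complete cD' [u _ fu] [u' _ fu'].
  exact: maps_onto_inj fu fu'.
by move=> mD [u Qu fu]; exists D, u.
Qed.

Lemma permutes_cliques_subgroup (Q : set W) : Q 1 ->
    (forall f u u', Q u -> Q u' -> Q (f u' * u)) ->
    (forall f u, Q u -> Q (f u)^-1) ->
  is_subgroup (permutes_cliques Q).
Proof.
move=> Q1 QM QV; split=> [D mD|f g fQ gQ D /gQ[D' [u' [mD' Qu' gu]]]|f fQ D mD].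
- by exists D, 1; split=> //; apply: maps_onto_id.
- have [E [u [mE Qu fu]]] := fQ D' mD'; exists E, (f u' * u); split=> //.
    exact: QM.
  exact: maps_onto_comp gu fu.
- have [D' [u [mD' Qu fu]]] := permutes_cliques_onto fQ mD.
  exists D', (f^-1 u)^-1; split=> //; first exact: QV.
  exact: maps_onto_inv.
Qed.

Lemma AutStar_subgroup : is_subgroup AutStar.
Proof. by rewrite AutStarE; apply: permutes_cliques_subgroup. Qed.

Lemma Aut1_subgroup : is_subgroup Aut1.
Proof.
rewrite Aut1E; apply: permutes_cliques_subgroup => //= [f _ _ -> ->|f _ ->].
  by rewrite aut1 mulg1.
by rewrite aut1 invg1.
Qed.

Lemma Aut1_AutStar : Aut1 `<=` AutStar.
Proof.
rewrite Aut1E AutStarE => f fP D /fP[E [u [mE _ fu]]]; by exists E, u.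
Qed.

Lemma clique_conjugating_AutStar : clique_conjugating (m := m) `<=` AutStar.
Proof.
rewrite AutStarE => f cf D mD; have [u fu] := cf D (max_complete_complete mD).
exists D, u; split=> // x.
have fE : forall y, P D y -> f y = u * y * u^-1.
  by apply: vertex_subgroup_morph_eq; [exact: autM|exact: conj_morph|].
split=> [Dx|Dy]; first by rewrite fE // (_ : _ * u = x) //; free_group.
suff <- : u^-1 * f x * u = x by [].
by apply: (aut_inj (f := f)); rewrite fE //; free_group.
Qed.

(** f(v_i) is conjugate to v_i and lies in some W(E); retracting there leaves only v_i or 1. *)
Lemma Aut1_clique_conjugating_trivial f :
  clique_conjugating f -> Aut1 f -> f = 1.
Proof.
rewrite Aut1E => cf fP; have [w fw] := clique_conjugating_vertex he cf.
apply/autP/presented_morph_eq; [exact: autM|exact: autM|move=> i].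
rewrite -/(v i) aut_oneE; have [D mD iD] := max_complete_vertex i.
have [E [_ [mE -> fE]]] := fP D mD.
have := (fE (v i)).1 (vertex_subgroup_vertex iD).
rewrite invg1 mul1g mulg1 => /retraction_id.
rewrite {1}fw retraction_conj; last exact: max_complete_complete.
rewrite retraction_vertex; case: ifP => // _ /esym fi.
by case: (vertex_neq1 hm (e := e) (i := i)); apply: (aut_inj (f := f));
  rewrite aut1.
Qed.

(* The image of v_i in W(E) does not depend on the cliques through v_i, since *)
(* distinct elements of the subgroups W(E), W(E') are not conjugate.          *)
Lemma clique_conj_unique D E u x y : complete e D -> complete e E ->
  P D x -> P E y -> y = u * x * u^-1 -> x = y.
Proof.
move=> cD cE Dx Ey yE.
have xy : rho E x = y by rewrite -(retraction_id Ey) yE retraction_conj.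
have yx : rho D y = x by rewrite -(retraction_id Dx) yE retraction_conj.
rewrite -yx; suff : P (D :&: E)%SET y.
  by move=> DEy; apply: retraction_id; apply: vertex_subgroupS DEy;
    apply: finset.subsetIl.
rewrite -xy -{1}(retraction_id Dx) retraction_comp finset.setIC;
  exact: retraction_in.
Qed.

Definition straightens f (a : W -> W) : Prop :=
  {morph a : x y / x * y} /\
  forall D E u, max_complete e D -> max_complete e E -> maps_onto f u D E ->
  forall x, P D x -> a x = u^-1 * f x * u.

(** Each defining relation involves a vertex or an edge, hence lives in one maximal clique, where
    [h] is f followed by a single conjugation. *)
Lemma straighten_exists f : AutStar f -> exists a, straightens f a.
Proof.
rewrite AutStarE => fP.
pose R i y := exists D E u,
  [/\ max_complete e D, max_complete e E, maps_onto f u D E, i \in D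
    & y = u^-1 * f (v i) * u].
have /choice[h hR] : forall i, exists y, R i y.
  move=> i; have [D mD iD] := max_complete_vertex i.
  have [E [u [mE _ fu]]] := fP D mD.
  by exists (u^-1 * f (v i) * u), D, E, u.
have hE D E u : max_complete e D -> max_complete e E -> maps_onto f u D E ->
    forall i, i \in D -> h i = u^-1 * f (v i) * u.
  move=> mD mE fu i iD; have [D' [E' [u' [mD' mE' fu' iD' ->]]]] := hR i.
  have Ei := (fu (v i)).1 (vertex_subgroup_vertex iD).
  have Ei' := (fu' (v i)).1 (vertex_subgroup_vertex iD').
  apply: (clique_conj_unique (u := u^-1 * u') _ _ Ei' Ei);
    [exact: max_complete_complete|exact: max_complete_complete|].
  by free_group.
have [i q mi|i j eij|a [aM av]] := @graph_product_lift N e m _ h.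
- have [D [E [u [_ _ _ _ ->]]]] := hR i.
  have -> : u^-1 * f (v i) * u = (f (v i)) ^ u by rewrite /conjg mulgA.
  have fX n : f (v i) ^+ n = f (v i ^+ n).
    by elim: n => [|n IHn]; rewrite ?aut1 // !expgS IHn autM.
  by rewrite -conjXg fX (vertex_order e mi) aut1 conj1g.
- have ji : j \in S i by rewrite inE eij orbT.
  have [D mD ijD] := max_complete_exists (complete_edge he ji).
  have [E [u [mE _ fu]]] := fP D mD.
  have iD : i \in D by apply: (fintype.subsetP ijD); rewrite !inE eqxx.
  have jD : j \in D by apply: (fintype.subsetP ijD); rewrite !inE eqxx orbT.
  rewrite (hE D E u) // (hE D E u mD mE fu j) //.
  apply: (complete_commute (max_complete_complete mE)); apply/fu;
    exact: vertex_subgroup_vertex.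
exists a; split=> // D E u mD mE fu.
apply: vertex_subgroup_morph_eq => // [x y|i iD].
  by rewrite autM; free_group.
by rewrite av (hE D E u).
Qed.

Lemma straighten_cancel f a b : AutStar f ->
  straightens f a -> straightens f^-1 b -> cancel a b.
Proof.
rewrite AutStarE => fP [aM aE] [bM bE].
apply: (presented_morph_eq (f := b \o a) (g := id)) => [x y|//|i].
  by rewrite /= aM bM.
rewrite -/(v i) /=; have [D mD iD] := max_complete_vertex i.
have [E [u [mE _ fu]]] := fP D mD.
have Di : P D (v i) by exact: vertex_subgroup_vertex.
rewrite (aE D E u) // (bE E D _ mE mD (maps_onto_inv fu)); last exact/fu.
by rewrite !autM !autV autK; free_group.
Qed.

Lemma AutStar_decomposition f : AutStar f ->
  exists2 a, Aut1 a & clique_conjugating (f * a^-1).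
Proof.
move=> sf; have [_ _ sV] := AutStar_subgroup; have sfV := sV _ sf.
have [a Ha] := straighten_exists sf; have [b Hb] := straighten_exists sfV.
have abK := straighten_cancel sf Ha Hb.
have baK : cancel b a by apply: straighten_cancel sfV Hb _; rewrite invgK.
have [[aM aE] [bM bE]] := (Ha, Hb).
pose al : aut W := Aut aM (Bijective abK baK).
have alE x : al x = a x by [].
move: (sf); rewrite AutStarE => fP.
exists al.
  rewrite Aut1E => D mD; have [E [u [mE _ fu]]] := fP D mD.
  exists E, 1; split=> // x; rewrite invg1 mul1g mulg1 alE.
  split=> [Dx|Ey]; first by rewrite (aE D E u) //; apply/fu.
  rewrite -(abK x) (bE E D _ mE mD (maps_onto_inv fu)) //.
  exact/(maps_onto_inv fu).
move=> D' cD'; have [E mE DE] := max_complete_exists cD'.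
(* With D the clique that f sends to E, each v_i in W(E) is a(x) for some x in W(D), where f(x) = u
   a(x) u^-1. *)
have [D [u [mD _ fu]]] := permutes_cliques_onto fP mE.
exists u => i iD'; pose x := f^-1 (u * v i * u^-1).
have fx : f x = u * v i * u^-1 by rewrite autVK.
have fxi : u^-1 * f x * u = v i by rewrite fx; free_group.
have Ei : P E (v i) by apply: vertex_subgroup_vertex;
  apply: (fintype.subsetP DE).
have Dx : P D x by apply/fu; rewrite fxi.
have ax : al x = v i by rewrite alE (aE D E u).
by rewrite aut_mulE -{1}ax autK.
Qed.

(** * Normalisation of Out^0 W by Aut^1 W *)

Section StarPreserving.
Hypothesis hstar : forall i f, Aut1 f ->
  f @` P (same_star e i) = P (same_star e i).

(** Distinct vertices with equal stars are adjacent, and S_i contains both or neither. *)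
Lemma same_star_component i k K : is_component e (~: S i)%SET K ->
  forall j, j \in same_star e k -> (j \in K) = (k \in K).
Proof.
move=> cK j; rewrite inE => /eqP skj; have [esym _] := he.
have [->//|njk] := eqVneq j k.
have jk : j \in S k by rewrite skj star_refl.
have ekj : e k j by move: jk; rewrite inE (negbTE njk).
have ijk : (j \in S i) = (k \in S i) by rewrite !(star_sym he _ i) -skj.
apply/idP/idP => [jK|kK].
  apply: (component_closed cK jK); first by rewrite esym.
  by rewrite finset.in_setC -ijk; have := component_sub cK jK;
    rewrite finset.in_setC.
apply: (component_closed cK kK ekj).
by rewrite finset.in_setC ijk; have := component_sub cK kK;
  rewrite finset.in_setC.
Qed.

(** f chi_iK f^-1 is the twist over K by f(v_i), which lies in W(Delta_i). All l in Delta_i share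
    S_i, hence K and j_i, so the chi_lK are in P^0. To check the twist at v_k, write v_k = f(y) with
    y in W(Delta_k); Delta_k lies inside K or misses it. *)
Lemma Aut1_normalises_Out0 f g : Aut1 f -> Out0 g -> Out0 (f * g * f^-1).
Proof.
move=> f1; apply: (generated_min (H := [set g | Out0 (f * g * f^-1)])).
  by apply: preim_subgroup (@conj_morph _ f) _; apply: Out0_subgroup.
move=> h [i [K [j [cK ji jmin jK th]]]] /=.
have ftP k : P (same_star e k) `<=` f @` P (same_star e k) by rewrite hstar.
have Dt : P (same_star e i) (f (v i)).
  rewrite -(hstar i f1); exists (v i) => //.
  by apply: vertex_subgroup_vertex; rewrite inE.
have DK k : k \in same_star e i -> k \notin K.
  by move=> /(same_star_component cK) ->; apply: component_notin cK.
have [|r Or tr] := twist_exists (@Out0_subgroup N e m) DK _ Dt.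
  move=> k; rewrite inE => /eqP sik.
  have cK' : is_component e (~: S k)%SET K by rewrite -sik.
  have [r tr] := partial_conj_exists m he cK'; exists r => //.
  by apply: generated_sub; exists k, K, j; rewrite -sik.
suff -> : f * h * f^-1 = r by [].
apply: twist_unique tr => k.
have [|y Dy fy] := ftP k (v k); first by apply: vertex_subgroup_vertex;
  rewrite inE.
have -> : (f * h * f^-1) (v k) = f (h y) by rewrite !aut_mulE -fy autK.
have hy : h y = if k \in K then v i * y * (v i)^-1 else y.
  case: ifP => kK; move: y Dy {fy}; apply: vertex_subgroup_morph_eq;
    try first [exact: autM|exact: conj_morph];
    by [|move=> l /(same_star_component cK) lk; rewrite th lk kK].
by rewrite hy; case: ifP => _; rewrite ?autJ fy.
Qed.

End StarPreserving.

End AutStar.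

(** * The semidirect decompositions *)

Theorem lemma8p8 (N : nat) (e : rel 'I_N) (m : 'I_N -> option nat)
    (hN : (0 < N)%N) (he : simplicial_graph e) (hm : order_map m)
    (hstar : forall (i : 'I_N) (phi : aut (graph_product e m)),
       Aut1 e m phi ->
       phi @` vertex_subgroup e m (same_star e i)
         = vertex_subgroup e m (same_star e i)) :
  [/\ internal_sdprod (Out0 e m) (Aut1 e m) (mul_set (Out0 e m) (Aut1 e m)),
      internal_sdprod (Inn (graph_product e m))
        (mul_set (Out0 e m) (Aut1 e m)) (AutStar e m)
    & internal_sdprod (Inn (graph_product e m))
        (OutStar e m) (AutStar e m)].
Proof.
set W := graph_product e m.
set O := Out0 e m; set A := Aut1 e m; set B := AutStar e m.
have sO : is_subgroup O by exact: Out0_subgroup.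
have sA : is_subgroup A by exact: Aut1_subgroup.
have sB : is_subgroup B by exact: AutStar_subgroup.
have sI : is_subgroup (Inn W) by exact: Inn_subgroup.
have nAO a o : A a -> O o -> O (a * o * a^-1)%g.
  exact: (Aut1_normalises_Out0 he hstar).
have sOA : is_subgroup (mul_set O A) by exact: mul_set_subgroup.
have [[O1 OM OV] [A1 AM AV] [B1 BM BV]] := And3 sO sA sB.
have OC : O `<=` @clique_conjugating N e m by exact: Out0_clique_conjugating.
have IC : Inn W `<=` @clique_conjugating N e m.
  by move=> _ /InnP[u ->]; apply: inner_clique_conjugating.
have [_ CM CV] := @clique_conjugating_subgroup N e m.
have OAsub : O `<=` mul_set O A by move=> o Oo; exists o, 1%g; rewrite mulg1.
have AOAsub : A `<=` mul_set O A by move=> a Aa; exists 1%g, a; rewrite mul1g.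
have OAB : mul_set O A `<=` B.
  move=> _ [o [a [/OC Co Aa ->]]]; apply: BM; last exact: Aut1_AutStar.
  exact: clique_conjugating_AutStar.
have IOA : internal_sdprod (Inn W) (mul_set O A) B.
  apply: internal_sdprodP => //.
  - by move=> f /IC; apply: clique_conjugating_AutStar.
  - by move=> f g _; apply: Inn_normal.
  - move=> f If [o [a [Oo Aa fE]]].
    (* Since o and f are clique-conjugating, so is a, which is therefore trivial. *)
    have aE : a = (o^-1 * f)%g by rewrite fE mulKg.
    have a1 : a = 1%g.
      apply: (Aut1_clique_conjugating_trivial he hm) Aa.
      by rewrite aE; apply: CM; [apply/CV/OC|apply: IC].
    by apply: (Inn_Out0_trivial he hm If); rewrite fE a1 mulg1.
  - move=> f /(AutStar_decomposition he hm)[a Aa].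
    move=> /(clique_conjugating_Inn_Out0 he hm)[g [o [Ig Oo fE]]].
    exists g, (o * a)%g; split=> //; first by exists o, a.
    by rewrite mulgA -fE mulgVK.
split=> //; last first.
  suff -> : OutStar e m = mul_set O A by [].
  apply/seteqP; split.
    apply: generated_min => // f [Pf|Af]; last exact: AOAsub.
    by apply: OAsub; apply: generated_sub.
  have [_ SM _] := generated_subgroupP (partial_conj0 e m `|` A).
  move=> _ [o [a [Oo Aa ->]]]; apply: SM; last by apply: generated_sub; right.
  move: o Oo; apply: generated_min; first exact: generated_subgroupP.
  by move=> f Pf; apply: generated_sub; left.
apply: internal_sdprodP => //; last first.
  by move=> f Of Af; apply: (Aut1_clique_conjugating_trivial he hm) Af;
    apply: OC.
move=> _ f [o [a [Oo Aa ->]]] Of.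
rewrite (_ : _ * _ * _ = o * (a * f * a^-1) * o^-1)%g; last by free_group.
exact: (OM _ _ (OM _ _ Oo (nAO _ _ Aa Of)) (OV _ Oo)).
Qed.
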